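(* The set $\mathcal C\big((\mathbb Z/2\mathbb Z\wr\mathbb Z)^3\big)$ of $l^2$-Betti numbers arising from the group $(\mathbb Z/2\mathbb Z\wr \mathbb Z)^3$ contains the number $$\frac1{64}- \frac18\sum_{k=1}^\infty \frac1{2^{k^2+4k+6}},$$ which is an irrational number.
   Context: For a countable discrete group $G$, the rational group ring $\mathbb Q G$ acts on $l^2G$ by convolution, and $M_k(\mathbb Q G)$ acts correspondingly on $(l^2G)^k$. The trace $\tau_G$ on $\mathbb Q G$ is $\tau_G(T)=\langle T\zeta_e,\zeta_e\rangle$, where $\zeta_e\in l^2G$ is the basis vector of the neutral element; the induced trace on $M_k(\mathbb Q G)\cong M_k(\mathbb Q)\otimes \mathbb Q G$ is $\operatorname{tr}\otimes\tau_G$ (with $\operatorname{tr}$ the non-normalized matrix trace), also denoted $\tau_G$, and extended to the weak closure. For self-adjoint $T\in M_k(\mathbb Q G)$, the spectral measure of $T$ is its projection-valued spectral measure composed with $\tau_G$, and $\dim_{vN}\ker T$ is the spectral measure of $\{0\}$ (i.e. $\tau_G$ of the orthogonal projection onto $\ker T$). For general $T$, $\dim_{vN}\ker T:=\dim_{vN}\ker T^*T$. A real number $r$ is an $l^2$-Betti number arising from $G$ if there are $k$ and $T\in M_k(\mathbb Q G)$ with $\dim_{vN}\ker T=r$; the set of all such $r$ is $\mathcal C(G)$. The lamplighter group $\mathbb Z/2\mathbb Z\wr\mathbb Z$ is the semidirect product $(\mathbb Z/2\mathbb Z)^{\oplus\mathbb Z}\rtimes\mathbb Z$ with respect to the shift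 action; $(\cdot)^3$ denotes threefold direct product. *)

(* Defs.v *)
From HB Require Import structures.
From mathcomp Require Import all_boot all_order all_algebra.
From mathcomp Require Import finmap complex monalg.
From mathcomp Require Import boolp classical_sets functions reals ereal.
From mathcomp Require Import topology normedtype sequences numfun esum.

Set Implicit Arguments.
Unset Strict Implicit.
Unset Printing Implicit Defensive.

Import GRing.Theory Num.Theory.
Local Open Scope ring_scope.

(* The library's ring structure on {malg R[K]} needs a monoid K in which only
   1 is invertible, so the group algebra product is set up here on an alias. *)
Definition group_ring (G : groupType) : Type := {malg rat[G]}.

HB.instance Definition _ (G : groupType) := GRing.Zmodule.on (group_ring G).

Section GroupRing.
Variable G : groupType.
Implicit Types a b c : {malg rat[G]}.

Definition gr_one : {malg rat[G]} := << 1 *g 1%g >>.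

Definition gr_mul a b : {malg rat[G]} :=
  \sum_(g <- msupp a) \sum_(h <- msupp b) << a@_g * b@_h *g (g * h)%g >>.

Lemma gr_mulw (d1 d2 : {fset G}) a b :
  (msupp a `<=` d1)%fset -> (msupp b `<=` d2)%fset ->
  gr_mul a b = \sum_(g <- d1) \sum_(h <- d2) << a@_g * b@_h *g (g * h)%g >>.
Proof.
move=> le1 le2; rewrite /gr_mul (big_fset_incl _ le1) /=.
  apply/eq_bigr => g _; apply/big_fset_incl => // h _ /mcoeff_outdom ->.
  by rewrite mulr0 monalgU0.
move=> g _ /mcoeff_outdom ag.
by rewrite big1 // => h _; rewrite ag mul0r monalgU0.
Qed.

Lemma gr_mulDl : left_distributive gr_mul +%R.
Proof.
move=> a b c.
rewrite (gr_mulw (msuppD_le a b) (fsubset_refl _)).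
rewrite (gr_mulw (fsubsetUl _ (msupp b)) (fsubset_refl _)).
rewrite (gr_mulw (fsubsetUr (msupp a) _) (fsubset_refl _)).
rewrite -big_split /=; apply/eq_bigr => g _.
rewrite -big_split /=; apply/eq_bigr => h _.
by rewrite mcoeffD mulrDl monalgUD.
Qed.

Lemma gr_mulDr : right_distributive gr_mul +%R.
Proof.
move=> a b c.
rewrite (gr_mulw (fsubset_refl _) (msuppD_le b c)).
rewrite (gr_mulw (fsubset_refl _) (fsubsetUl _ (msupp c))).
rewrite (gr_mulw (fsubset_refl _) (fsubsetUr (msupp b) _)).
rewrite -big_split /=; apply/eq_bigr => g _.
rewrite -big_split /=; apply/eq_bigr => h _.
by rewrite mcoeffD mulrDr monalgUD.
Qed.

Lemma gr_mul0l : left_zero 0 gr_mul.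
Proof. by move=> a; rewrite /gr_mul msupp0 big_seq_fset0. Qed.

Lemma gr_mul0r : right_zero 0 gr_mul.
Proof. by move=> a; rewrite /gr_mul big1 // => g _; rewrite msupp0 big_seq_fset0. Qed.

Lemma gr_mulUU (x y : rat) (g h : G) :
  gr_mul << x *g g >> << y *g h >> = << x * y *g (g * h)%g >>.
Proof. by rewrite (gr_mulw msuppU_le msuppU_le) !big_seq_fset1 !mcoeffUU. Qed.

Lemma gr_mul_suml (I : Type) (s : seq I) (F : I -> {malg rat[G]}) b :
  gr_mul (\sum_(i <- s) F i) b = \sum_(i <- s) gr_mul (F i) b.
Proof.
exact: (big_morph (gr_mul^~ b) (fun _ _ => gr_mulDl _ _ _) (gr_mul0l _)).
Qed.

Lemma gr_mul_sumr (I : Type) (s : seq I) (F : I -> {malg rat[G]}) a :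
  gr_mul a (\sum_(i <- s) F i) = \sum_(i <- s) gr_mul a (F i).
Proof.
exact: (big_morph (gr_mul a) (fun _ _ => gr_mulDr _ _ _) (gr_mul0r _)).
Qed.

Lemma gr_mul1l : left_id gr_one gr_mul.
Proof.
move=> a; rewrite {1}[a]monalgE gr_mul_sumr [RHS]monalgE.
by apply/eq_bigr => g _; rewrite gr_mulUU mul1r mul1g.
Qed.

Lemma gr_mul1r : right_id gr_one gr_mul.
Proof.
move=> a; rewrite {1}[a]monalgE gr_mul_suml [RHS]monalgE.
by apply/eq_bigr => g _; rewrite gr_mulUU mulr1 mulg1.
Qed.

Lemma gr_mulA : associative gr_mul.
Proof.
move=> a b c; rewrite [a]monalgE !gr_mul_suml; apply/eq_bigr => g _.
rewrite [b]monalgE !(gr_mul_suml, gr_mul_sumr); apply/eq_bigr => h _.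
rewrite [c]monalgE !gr_mul_sumr; apply/eq_bigr => k _.
by rewrite !gr_mulUU mulrA mulgA.
Qed.

Lemma gr_one_neq0 : gr_one != 0.
Proof. by rewrite monalgU_eq0 oner_eq0. Qed.

HB.instance Definition _ := GRing.Zmodule_isNzRing.Build (group_ring G)
  gr_mulA gr_mul1l gr_mul1r gr_mulDl gr_mulDr gr_one_neq0.

(* The involution of the group ring; rational coefficients are their own
   complex conjugates. *)
Definition gr_star (a : group_ring G) : group_ring G :=
  \sum_(g <- msupp a) << a@_g *g g^-1%g >>.

Definition adjmx (k : nat) (T : 'M[group_ring G]_k) : 'M[group_ring G]_k :=
  \matrix_(i, j) gr_star (T j i).

End GroupRing.

Section HilbertSpace.
Variable R : realType.
Local Open Scope classical_set_scope.

Definition l2 (I : choiceType) : set (I -> R[i]) :=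
  [set f | (\esum_(x in [set: I]) (complex.Re (`|f x| ^+ 2))%:E < +oo)%E].

(* Sums of absolutely summable families; for non-summable families the value
   is junk. *)
Definition rsum (I : choiceType) (u : I -> R) : R :=
  fine (\esum_(x in [set: I]) (EFin \o u)^\+ x
        - \esum_(x in [set: I]) (EFin \o u)^\- x)%E.

Definition csum (I : choiceType) (u : I -> R[i]) : R[i] :=
  Complex (rsum (fun x => complex.Re (u x))) (rsum (fun x => complex.Im (u x))).

Definition inner (I : choiceType) (f g : I -> R[i]) : R[i] :=
  csum (fun x => f x * (g x)^*).

Variable G : groupType.

Definition l2pow (k : nat) : set ('I_k -> G -> R[i]) :=
  [set v | forall i, l2 (v i)].

Definition inner_pow (k : nat) (v w : 'I_k -> G -> R[i]) : R[i] :=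
  \sum_(i < k) inner (v i) (w i).

(* The vector \zeta_e placed in the i-th summand of (l^2 G)^k. *)
Definition zeta (k : nat) (i : 'I_k) : 'I_k -> G -> R[i] :=
  fun j x => ((j == i) && (x == 1%g))%:R.

(* Left convolution, so that g acts by \zeta_h |-> \zeta_(g h). *)
Definition conv (a : group_ring G) (f : G -> R[i]) : G -> R[i] :=
  fun x => \sum_(g <- msupp a) ratr a@_g * f (g^-1 * x)%g.

Definition mxact (k : nat) (T : 'M[group_ring G]_k) (v : 'I_k -> G -> R[i]) :
    'I_k -> G -> R[i] :=
  fun i x => \sum_(j < k) conv (T i j) (v j) x.

Definition l2ker (k : nat) (T : 'M[group_ring G]_k) : set ('I_k -> G -> R[i]) :=
  [set v | l2pow v /\ forall i x, mxact T v i x = 0].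

(* Only the values of P on (l^2 G)^k matter. *)
Definition is_orth_proj (k : nat) (K : set ('I_k -> G -> R[i]))
    (P : ('I_k -> G -> R[i]) -> ('I_k -> G -> R[i])) : Prop :=
  forall v, l2pow v ->
    K (P v) /\ forall w, K w -> inner_pow (fun i x => v i x - P v i x) w = 0.

(* tr \otimes \tau_G, with the non-normalized matrix trace. *)
Definition vn_trace (k : nat) (P : ('I_k -> G -> R[i]) -> ('I_k -> G -> R[i])) :
    R[i] :=
  \sum_(i < k) inner_pow (P (zeta i)) (zeta i).

(* For self-adjoint S, the projection onto ker S is the value of the spectral
   projection-valued measure of S on {0}. *)
Definition is_dim_ker_sa (k : nat) (S : 'M[group_ring G]_k) (r : R) : Prop :=
  exists2 P, is_orth_proj (l2ker S) P & vn_trace P = (r%:C)%C.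

Definition is_dim_ker (k : nat) (T : 'M[group_ring G]_k) (r : R) : Prop :=
  is_dim_ker_sa (adjmx T *m T) r.

End HilbertSpace.

Definition l2_betti (R : realType) (G : groupType) : set R :=
  [set r | exists k, exists T : 'M[group_ring G]_k, is_dim_ker T r]%classic.

(* A pair (f, n) stands for f n, and n acts on f by f(i) |-> f(i - n). *)
Definition lamplighter : Type := ({malg 'Z_2[int]} * int)%type.

HB.instance Definition _ := Choice.on lamplighter.

Section Lamplighter.
Implicit Types (f : {malg 'Z_2[int]}) (m n i : int) (x y z : lamplighter).

Definition shift n f : {malg 'Z_2[int]} :=
  \sum_(i <- msupp f) << f@_i *g i + n >>.

Lemma shiftE n f i : (shift n f)@_i = f@_(i - n).
Proof.
rewrite /shift raddf_sum /=; under eq_bigr do rewrite mcoeffU.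
rewrite {3}[f]monalgE raddf_sum /=; apply: eq_bigr => j _.
by rewrite mcoeffU [j == _]eq_sym subr_eq eq_sym.
Qed.

Lemma shiftD n f g : shift n (f + g) = shift n f + shift n g.
Proof. by apply/malgP => i; rewrite mcoeffD !shiftE mcoeffD. Qed.

Lemma shift_add m n f : shift (m + n) f = shift m (shift n f).
Proof. by apply/malgP => i; rewrite !shiftE opprD addrA. Qed.

Lemma shift0 f : shift 0 f = f.
Proof. by apply/malgP => i; rewrite shiftE subr0. Qed.

Lemma shift_0 n : shift n 0 = 0.
Proof. by apply/malgP => i; rewrite shiftE !mcoeff0. Qed.

Definition ll_one : lamplighter := (0, 0).
Definition ll_mul x y : lamplighter := (x.1 + shift x.2 y.1, x.2 + y.2).
Definition ll_inv x : lamplighter := (shift (- x.2) (- x.1), - x.2).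

Lemma ll_mulA : associative ll_mul.
Proof.
by move=> x y z; rewrite /ll_mul /= shiftD shift_add !addrA.
Qed.

Lemma ll_mul1 : left_id ll_one ll_mul.
Proof. by case=> f n; rewrite /ll_mul /= shift0 !add0r. Qed.

Lemma ll_mulr1 : right_id ll_one ll_mul.
Proof. by case=> f n; rewrite /ll_mul /= shift_0 !addr0. Qed.

Lemma ll_mulV : left_inverse ll_one ll_inv ll_mul.
Proof. by case=> f n; rewrite /ll_mul /= -shiftD !addNr shift_0. Qed.

Lemma ll_mulrV : right_inverse ll_one ll_inv ll_mul.
Proof. by case=> f n; rewrite /ll_mul /= -shift_add !subrr shift0 subrr. Qed.

HB.instance Definition _ := isGroup.Build lamplighter
  ll_mulA ll_mul1 ll_mulr1 ll_mulV ll_mulrV.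

End Lamplighter.

(* Main.v *)
(* The projections (1 + a_m) / 2 and (1 - a_m) / 2 of the lamps say that a tape
   holds 0 or 1 at m.  With t the shift, ((1 + a_0) / 2) t moves a head through
   a maximal block of zeros: it is a direct sum of truncated shifts of all sizes
   n >= 1, the one of size n occurring with weight 2^-(n + 1).

   On three tapes let T : 'M_3 be such that T v = 0 forces v to be constant
   along the runs of a reversible machine with three states, and 0 elsewhere. A
   run starts at the left ends of the blocks of the tapes 1 and 2, at a
   position >= 4 on tape 3. It walks along the diagonal of the n1 x n2 block;
   it continues only when it reaches the opposite corner, i.e. if n1 = n2 = n,
   and n >= 2. Then it scans the n x n block row by row in alternating
   directions, consuming one zero of tape 3 at each of its n^2 steps, and v is
   required to vanish where the scan ends. So each run contributes its weight,
   except those where n1 = n2 = n >= 2 and tape 3 has n^2 further zeros. The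
   weights of all runs sum up to 1 / 64, those of the excluded runs with
   n = k + 1 to 2^-(k^2 + 4 k + 9).

   The projections onto finite sets of runs lie in the matrices over the group
   ring, so their traces are finite sums, and they increase to the projection
   onto the kernel.  The number is irrational because the gaps in its binary
   expansion are unbounded. *)

Require Import Defs.
From HB Require Import structures.
From mathcomp Require Import all_boot all_order all_algebra.
From mathcomp Require Import finmap complex monalg.
From mathcomp Require Import boolp classical_sets functions cardinality fsbigop.
From mathcomp Require Import reals ereal topology normedtype sequences numfun esum.
From mathcomp Require Import ring lra zify.

Set Implicit Arguments.
Unset Strict Implicit.
Unset Printing Implicit Defensive.

Import Order.TTheory GRing.Theory Num.Theory.
Import numFieldNormedType.Exports.
Local Open Scope ring_scope.

(** * The group ring and its action by convolution *)

(** Each equation says that the value at a configuration is the sum of the values at its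
    predecessors. Reversibility leaves at most one predecessor, so a solution is determined by its
    values at the starts, where the equation is void. Infinite blocks of zeros have weight 0, since
    the projection onto a run of N zeros has trace 2^-N. Hence nothing of l^2 is lost by looking at
    finite boxes only, and there the equations become a finite combinatorial system. The exponents
    are quadratic because the scan covers an area: tape 3 must supply n^2 zeros, which costs a
    factor 2^-(n^2). Starting at position p or later on tape 3 multiplies the total weight 1/4 and
    every excluded weight by 2^-p; p = 4 produces 1/64 and, with it, the factor 1/8 before the
    series. A run counts once, whatever its length: the sum x of the matrix units from the corner of
    the box to the configurations of the run satisfies adj(x) x = len P, so len^-1 x adj(x) is a
    projection with the trace of P. The condition at the end of the scan is a second matrix. Since
    the coefficients are rational, all the analysis is done on real vectors. *)

Section GroupRingTheory.
Variable G : groupType.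
Implicit Types (a b : group_ring G) (g h : G) (c d : rat).

Definition mon c g : group_ring G := << c *g g >>.

Lemma coefD a b g : (a + b)@_g = a@_g + b@_g. Proof. exact: mcoeffD. Qed.
Lemma coefN a g : (- a)@_g = - a@_g. Proof. exact: mcoeffN. Qed.
Lemma coef0 g : (0 : group_ring G)@_g = 0. Proof. exact: mcoeff0. Qed.
Lemma coef_mon c g h : (mon c g)@_h = c *+ (g == h). Proof. exact: mcoeffU. Qed.

Lemma coef_sum (I : Type) (s : seq I) (P : pred I) (F : I -> group_ring G) g :
  (\sum_(i <- s | P i) F i)@_g = \sum_(i <- s | P i) (F i)@_g.
Proof.
exact: (big_morph (fun a : group_ring G => a@_g)
  (fun a b => coefD a b g) (coef0 g)).
Qed.

Lemma coefP a b : (forall g, a@_g = b@_g) -> a = b.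
Proof. by move=> h; apply/malgP. Qed.

Lemma monM c d g h : mon c g * mon d h = mon (c * d) (g * h)%g.
Proof. exact: gr_mulUU. Qed.

Lemma monD c d g : mon (c + d) g = mon c g + mon d g.
Proof. exact: monalgUD. Qed.

Lemma gr_ind (P : group_ring G -> Prop) :
  P 0 -> (forall c g, P (mon c g)) -> (forall a b, P a -> P b -> P (a + b)) ->
  forall a, P a.
Proof.
move=> P0 Pm PD a; rewrite [a]monalgE.
by apply: (big_ind P) => // g _; exact: Pm.
Qed.

Lemma coef_star a g : (gr_star a)@_g = a@_(g^-1)%g.
Proof.
rewrite /gr_star coef_sum [a in RHS]monalgE coef_sum; apply: eq_bigr => h _.
by rewrite !mcoeffU eqg_invLR.
Qed.

Lemma star_mon c g : gr_star (mon c g) = mon c g^-1%g.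
Proof. by apply: coefP => h; rewrite coef_star !coef_mon eqg_invLR. Qed.

Lemma star_is_zmod_morphism : zmod_morphism (@gr_star G).
Proof.
by move=> a b; apply: coefP => g; rewrite !(coef_star, coefD, coefN).
Qed.

HB.instance Definition _ :=
  GRing.isZmodMorphism.Build (group_ring G) (group_ring G) (@gr_star G)
    star_is_zmod_morphism.

Lemma starM a b : gr_star (a * b) = gr_star b * gr_star a.
Proof.
elim/gr_ind: a => [|c g|a1 a2 h1 h2]; first by rewrite mul0r raddf0 mulr0.
  elim/gr_ind: b => [|d h|b1 b2 h1 h2]; first by rewrite mulr0 raddf0 mul0r.
    by rewrite monM !star_mon monM invgM mulrC.
  by rewrite mulrDr !raddfD /= h1 h2 mulrDl.
by rewrite mulrDl !raddfD /= h1 h2 mulrDr.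
Qed.

Lemma starK a : gr_star (gr_star a) = a.
Proof. by apply: coefP => g; rewrite !coef_star invgK. Qed.

Lemma oneE : (1 : group_ring G) = mon 1 1%g. Proof. by []. Qed.

Lemma star1 : gr_star (1 : group_ring G) = 1.
Proof. by rewrite oneE star_mon invg1. Qed.

(** Traciality makes the weight of a run computable: an element times its adjoint has the same trace
    as the adjoint times the element. *)
Lemma trC a b : (a * b)@_1%g = (b * a)@_1%g.
Proof.
elim/gr_ind: a => [|c g|a1 a2 h1 h2]; first by rewrite mul0r mulr0.
  elim/gr_ind: b => [|d h|b1 b2 h1 h2]; first by rewrite mul0r mulr0.
    by rewrite !monM !coef_mon mulrC !mulg_eq1 eq_sym eqg_invLR.
  by rewrite mulrDr mulrDl !coefD h1 h2.
by rewrite mulrDr mulrDl !coefD h1 h2.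
Qed.

Lemma coef_mon_mul c g a h : (mon c g * a)@_h = c * a@_(g^-1 * h)%g.
Proof.
elim/gr_ind: a => [|d k|a1 a2 h1 h2]; first by rewrite mulr0 !coef0 mulr0.
  by rewrite monM !coef_mon mulrnAr -(inj_eq (mulgI g^-1)%g) mulKg.
by rewrite mulrDr !coefD h1 h2 mulrDr.
Qed.

End GroupRingTheory.

(** * Tensor products of group rings *)

Section Tensor.
Variables G H : groupType.
Implicit Types (a : group_ring G) (b : group_ring H).

Definition ten a b : group_ring (G * H)%type :=
  \sum_(g <- msupp a) \sum_(h <- msupp b) mon (a@_g * b@_h) (g, h).

Lemma coef_ten a b x : (ten a b)@_x = a@_(x.1) * b@_(x.2).
Proof.
rewrite /ten coef_sum [a in RHS]monalgE coef_sum big_distrl /=.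
apply: eq_bigr => g _; rewrite mcoeffU coef_sum.
rewrite [b in RHS]monalgE coef_sum big_distrr /=.
apply: eq_bigr => h _; rewrite coef_mon mcoeffU.
by case: x => x y; rewrite /= xpair_eqE mulrnAr mulrnAl -mulrnA mulnb andbC.
Qed.

Lemma tenDl a1 a2 b : ten (a1 + a2) b = ten a1 b + ten a2 b.
Proof. by apply: coefP => x; rewrite coefD !coef_ten coefD mulrDl. Qed.

Lemma tenDr a b1 b2 : ten a (b1 + b2) = ten a b1 + ten a b2.
Proof. by apply: coefP => x; rewrite coefD !coef_ten coefD mulrDr. Qed.

Lemma ten0l b : ten 0 b = 0.
Proof. by apply: coefP => x; rewrite coef_ten !coef0 mul0r. Qed.

Lemma ten0r a : ten a 0 = 0.
Proof. by apply: coefP => x; rewrite coef_ten !coef0 mulr0. Qed.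

Lemma tenNl a b : ten (- a) b = - ten a b.
Proof. by apply: coefP => x; rewrite coefN !coef_ten coefN mulNr. Qed.

Lemma ten_mon c d g h : ten (mon c g) (mon d h) = mon (c * d) (g, h).
Proof.
apply: coefP => -[x y]; rewrite coef_ten !coef_mon /= xpair_eqE.
by rewrite mulrnAr mulrnAl -mulrnA mulnb andbC.
Qed.

Lemma ten11 : ten 1 1 = 1.
Proof. by rewrite !oneE ten_mon mulr1. Qed.

Lemma tenM a1 a2 b1 b2 : ten a1 b1 * ten a2 b2 = ten (a1 * a2) (b1 * b2).
Proof.
elim/gr_ind: a1 => [|c g|a a' h h']; first by rewrite !(ten0l, mul0r).
  elim/gr_ind: a2 => [|d k|a a' h h']; first by rewrite !(ten0l, mul0r, mulr0).
    elim/gr_ind: b1 => [|c' g'|b b' h h']; first by rewrite !(ten0r, mul0r).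
      elim/gr_ind: b2 => [|d' k'|b b' h h']; first by rewrite !(ten0r, mulr0).
        by rewrite !ten_mon !monM ten_mon mulrACA.
      by rewrite tenDr !mulrDr h h' tenDr.
    by rewrite tenDr mulrDl h h' mulrDl tenDr.
  by rewrite tenDl !mulrDr h h' tenDl.
by rewrite tenDl mulrDl h h' mulrDl tenDl.
Qed.

Lemma star_ten a b : gr_star (ten a b) = ten (gr_star a) (gr_star b).
Proof. by apply: coefP => x; rewrite coef_star !coef_ten !coef_star. Qed.

End Tensor.

Section Convolution.
Variables (F : numFieldType) (G : groupType).
Implicit Types (a b : group_ring G) (f h : G -> F).

(** The formula of [conv] over any field of scalars. The coefficients are rational, so the analysis
    can be done over the reals and transferred to complex vectors at the end. *)
Definition rconv a f : G -> F :=
  fun x => \sum_(g <- msupp a) ratr a@_g * f (g^-1 * x)%g.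

Lemma rconvEw (d : {fset G}) a f x : (msupp a `<=` d)%fset ->
  rconv a f x = \sum_(g <- d) ratr a@_g * f (g^-1 * x)%g.
Proof.
move=> le; rewrite /rconv (big_fset_incl _ le) //= => g _ /mcoeff_outdom ->.
by rewrite rmorph0 mul0r.
Qed.

Lemma rconvDl a b f : rconv (a + b) f = rconv a f + rconv b f.
Proof.
apply/funext => x; rewrite /= (rconvEw _ _ (msuppD_le a b)).
rewrite /GRing.add /= (rconvEw _ _ (fsubsetUl _ (msupp b))).
rewrite (rconvEw _ _ (fsubsetUr (msupp a) _)) -big_split /=.
by apply: eq_bigr => g _; rewrite mcoeffD rmorphD mulrDl.
Qed.

Lemma rconv0l f : rconv 0 f = 0.
Proof. by apply/funext => x; rewrite /rconv msupp0 big_seq_fset0. Qed.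

Lemma rconvNl a f : rconv (- a) f = - rconv a f.
Proof. by apply/eqP; rewrite -addr_eq0 -rconvDl addNr rconv0l. Qed.

Lemma rconvBl a b f : rconv (a - b) f = rconv a f - rconv b f.
Proof. by rewrite rconvDl rconvNl. Qed.

Lemma rconv_mon c g f x : rconv (mon c g) f x = ratr c * f (g^-1 * x)%g.
Proof.
by rewrite (rconvEw _ _ msuppU_le) big_seq_fset1 /= coef_mon eqxx.
Qed.

Lemma rconv1 f : rconv 1 f = f.
Proof.
by apply/funext => x; rewrite oneE rconv_mon rmorph1 mul1r invg1 mul1g.
Qed.

Lemma rconvDr a f h : rconv a (f + h) = rconv a f + rconv a h.
Proof.
apply/funext => x; rewrite /rconv /GRing.add /= -big_split /=.
by apply: eq_bigr => g _; rewrite -mulrDr.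
Qed.

Lemma rconvZr a (c : F) f : rconv a (fun x => c * f x) = (fun x => c * rconv a f x).
Proof.
apply/funext => x; rewrite /rconv big_distrr /=.
by apply: eq_bigr => g _; rewrite mulrCA.
Qed.

Lemma rconv_is_zmod_morphism a : zmod_morphism (rconv a).
Proof.
move=> f h; rewrite rconvDr; congr (_ + _); apply/funext => x.
rewrite /rconv /GRing.opp /= -sumrN.
by apply: eq_bigr => g _; rewrite -mulrN.
Qed.

HB.instance Definition _ a :=
  GRing.isZmodMorphism.Build (G -> F) (G -> F) (rconv a)
    (rconv_is_zmod_morphism a).

Lemma rconvBr a f h : rconv a (f - h) = rconv a f - rconv a h.
Proof. exact: raddfB. Qed.

Lemma rconv0r a : rconv a 0 = 0.
Proof. exact: raddf0. Qed.

Lemma rconvM a b f : rconv (a * b) f = rconv a (rconv b f).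
Proof.
elim/gr_ind: a => [|c g|a1 a2 h1 h2]; first by rewrite mul0r !rconv0l.
  elim/gr_ind: b => [|d h|b1 b2 h1 h2]; first by rewrite mulr0 !rconv0l raddf0.
    apply/funext => x.
    by rewrite monM !rconv_mon rmorphM /= invgM mulrA mulgA.
  by rewrite mulrDr !rconvDl h1 h2 rconvDr.
by rewrite mulrDl !rconvDl h1 h2.
Qed.

Lemma rconv_suml (I : Type) (s : seq I) (P : pred I) (E : I -> group_ring G) f :
  rconv (\sum_(i <- s | P i) E i) f = \sum_(i <- s | P i) rconv (E i) f.
Proof.
exact: (big_morph (rconv^~ f) (fun a b => rconvDl a b f) (rconv0l f)).
Qed.

Definition delta (x : G) : G -> F := fun y => (y == x)%:R.

Lemma rconv_delta a x : rconv a (delta 1%g) x = ratr a@_x.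
Proof.
elim/gr_ind: a => [|c g|a1 a2 h1 h2]; first by rewrite rconv0l coef0 rmorph0.
  rewrite rconv_mon coef_mon /delta mulg_eq1 eqg_inv.
  by case: eqP => _; rewrite ?mulr1 ?mulr0 ?mulr1n ?mulr0n ?rmorph0.
by rewrite rconvDl {1}/GRing.add /= h1 h2 coefD rmorphD.
Qed.

End Convolution.

(** * Square-summable families *)

Section RealSums.
Variables (R : realType) (I : choiceType).
Implicit Types (u v p q : I -> R).

Definition asum u := summable [set: I]%classic (EFin \o u).

Lemma esum_le_bound u (C : R) : (forall F : {fset I}, \sum_(x <- F) u x <= C) ->
  (\esum_(x in [set: I]) (u x)%:E <= C%:E)%E.
Proof.
move=> h; apply: ge_ereal_sup => _ [X [finX _] <-].
by rewrite fsbig_finite //= sumEFin lee_fin.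
Qed.

Lemma le_fsum_esum u (F : {fset I}) :
  ((\sum_(x <- F) u x)%:E <= \esum_(x in [set: I]) (u x)%:E)%E.
Proof.
rewrite -sumEFin fsbig_seq //; apply: ereal_sup_ubound.
by exists [set` F]%classic; split => //; exact: finite_fset.
Qed.

Lemma asumE u : asum u = (\esum_(x in [set: I]) `|u x|%:E < +oo)%E.
Proof. by []. Qed.

Lemma asumP u :
  asum u <-> exists C, forall F : {fset I}, \sum_(x <- F) `|u x| <= C.
Proof.
rewrite asumE; split => [lt_oo|[C hC]]; last first.
  exact: le_lt_trans (esum_le_bound hC) (ltry _).
have fin : (\esum_(x in [set: I]) `|u x|%:E \is a fin_num)%E.
  by rewrite ge0_fin_numE // esum_ge0 // => x _; rewrite lee_fin.
exists (fine (\esum_(x in [set: I]) `|u x|%:E)%E) => F.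
by rewrite -lee_fin fineK //; exact: (le_fsum_esum (fun x => `|u x|)).
Qed.

Lemma asum_le u v : (forall x, `|u x| <= v x) -> asum v -> asum u.
Proof.
move=> le_uv; rewrite /asum /summable; apply: le_lt_trans.
apply: le_esum => x _ /=; rewrite lee_fin (le_trans (le_uv x)) //.
exact: ler_norm.
Qed.

Lemma asumD u v : asum u -> asum v -> asum (u + v).
Proof. exact: summableD. Qed.

Lemma asumN u : asum u -> asum (- u).
Proof. by move=> hu; rewrite /asum -[_ \o _]/(\- (EFin \o u))%E -summableN. Qed.

Lemma asumZ (c : R) u : asum u -> asum (fun x => c * u x).
Proof.
move=> /asumP[C hC]; apply/asumP; exists (`|c| * C) => F.
under eq_bigr do rewrite normrM.
by rewrite -big_distrr /= ler_wpM2l.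
Qed.

Lemma asum_abs u : asum u -> asum (fun x => `|u x|).
Proof.
move=> /asumP[C hC]; apply/asumP; exists C => F.
by under eq_bigr do rewrite normr_id.
Qed.

Lemma esum_fin p : asum p -> (forall x, 0 <= p x) ->
  (\esum_(x in [set: I]) (p x)%:E \is a fin_num)%E.
Proof.
move=> hp p0; rewrite ge0_fin_numE; last first.
  by apply: esum_ge0 => x _; rewrite lee_fin.
by move: hp; rewrite asumE; under eq_esum do rewrite ger0_norm //.
Qed.

Lemma rsumB_ge0 p q : asum p -> asum q ->
    (forall x, 0 <= p x) -> (forall x, 0 <= q x) ->
  rsum (p - q) = fine (\esum_(x in [set: I]) (p x)%:E)%E
               - fine (\esum_(x in [set: I]) (q x)%:E)%E.
Proof.
move=> hp hq p0 q0; rewrite -fineB ?esum_fin // /rsum.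
by congr fine; rewrite -[RHS](esumB hp hq) // => x _; rewrite lee_fin.
Qed.

Lemma rsum_ge0E p : asum p -> (forall x, 0 <= p x) ->
  rsum p = fine (\esum_(x in [set: I]) (p x)%:E)%E.
Proof.
move=> hp p0; have h0 : asum (0 : I -> R).
  by apply/asumP; exists 0 => F; rewrite big1 // => x _; rewrite normr0.
rewrite -[in LHS](subr0 p) rsumB_ge0 //.
by rewrite [X in _ - fine X]esum1 ?subr0.
Qed.

Lemma rsumB_rsum p q : asum p -> asum q ->
    (forall x, 0 <= p x) -> (forall x, 0 <= q x) ->
  rsum (p - q) = rsum p - rsum q.
Proof.
by move=> hp hq p0 q0; rewrite (rsumB_ge0 hp hq p0 q0) (rsum_ge0E hp p0) (rsum_ge0E
  hq q0).
Qed.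

Lemma rsumD_ge0 p q : asum p -> asum q ->
    (forall x, 0 <= p x) -> (forall x, 0 <= q x) ->
  rsum (p + q) = rsum p + rsum q.
Proof.
move=> hp hq p0 q0; have pq0 x : 0 <= (p + q) x by apply: addr_ge0.
rewrite (rsum_ge0E (asumD hp hq) pq0) (rsum_ge0E hp p0) (rsum_ge0E hq q0).
rewrite -fineD ?esum_fin //; congr fine.
by rewrite -esumD // => x _; rewrite lee_fin.
Qed.

Lemma rsum0 : rsum (0 : I -> R) = 0.
Proof.
rewrite rsum_ge0E ?esum1 //.
by apply/asumP; exists 0 => F; rewrite big1 // => x _; rewrite normr0.
Qed.

Lemma fsum_le_rsum p (F : {fset I}) : asum p -> (forall x, 0 <= p x) ->
  \sum_(x <- F) p x <= rsum p.
Proof.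
move=> hp p0; rewrite rsum_ge0E // -lee_fin fineK ?esum_fin //.
exact: le_fsum_esum.
Qed.

Lemma rsum_le_bound p (C : R) : (forall x, 0 <= p x) ->
  (forall F : {fset I}, \sum_(x <- F) p x <= C) -> asum p /\ rsum p <= C.
Proof.
move=> p0 hC; have hp : asum p.
  by apply/asumP; exists C => F; under eq_bigr do rewrite ger0_norm //.
split=> //; rewrite rsum_ge0E // -lee_fin fineK ?esum_fin //.
exact: esum_le_bound.
Qed.

Lemma rsum_ge0 p : asum p -> (forall x, 0 <= p x) -> 0 <= rsum p.
Proof. by move=> hp p0; have := fsum_le_rsum fset0 hp p0; rewrite big_seq_fset0. Qed.

Lemma rsum_reindex (e : I -> I) u :
  bijective e -> rsum (u \o e) = rsum u.
Proof.
rewrite -setTT_bijective => he; rewrite /rsum; congr fine.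
congr (_ - _)%E; symmetry.
  rewrite (reindex_esum _ _ _ (EFin \o u)^\+%E he).
  by apply: eq_esum => x _; rewrite !funeposE.
rewrite (reindex_esum _ _ _ (EFin \o u)^\-%E he).
by apply: eq_esum => x _; rewrite !funenegE.
Qed.

Lemma asum_reindex (e : I -> I) u :
  bijective e -> asum u -> asum (u \o e).
Proof.
by rewrite -setTT_bijective => he; rewrite /asum /summable (reindex_esum _ _ _ _ he).
Qed.

Opaque asum rsum.

Let pos u : I -> R := fun x => Num.max (u x) 0.
Let posB u : u = pos u - pos (- u).
Proof.
apply/funext => x; rewrite /pos /GRing.add /GRing.opp /=.
by case: (leP (u x) 0); case: (leP (- u x) 0) => *; lra.
Qed.
Let pos_ge0 u x : 0 <= pos u x. Proof. by rewrite le_max lexx orbT. Qed.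
Let pos_asum u : asum u -> asum (pos u).
Proof.
move=> /asum_abs; apply: asum_le => x; rewrite /pos.
by case: (leP (u x) 0); rewrite ?normr0 ?normr_ge0.
Qed.

(** Additivity is first known for nonnegative families; [u + v] is the difference of two of them,
    [pos u + pos v] and [pos (- u) + pos (- v)]. *)
Lemma rsumD u v : asum u -> asum v -> rsum (u + v) = rsum u + rsum v.
Proof.
move=> hu hv; have hu' := pos_asum (asumN hu); have hv' := pos_asum (asumN hv).
have hpu := pos_asum hu; have hpv := pos_asum hv.
have e : u + v = (pos u + pos v) - (pos (- u) + pos (- v)).
  by rewrite opprD addrACA -!posB.
have ge0 f g x : 0 <= (pos f + pos g) x.
  by apply: addr_ge0; exact: pos_ge0.
rewrite [in LHS]e rsumB_rsum; [|exact: asumD|exact: asumD|exact: ge0|exact: ge0].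
rewrite (rsumD_ge0 hpu hpv (pos_ge0 u) (pos_ge0 v)).
rewrite (rsumD_ge0 hu' hv' (pos_ge0 _) (pos_ge0 _)).
rewrite [u in RHS]posB [v in RHS]posB.
rewrite (rsumB_rsum hpu hu' (pos_ge0 _) (pos_ge0 _)).
rewrite (rsumB_rsum hpv hv' (pos_ge0 _) (pos_ge0 _)).
by rewrite opprD addrACA.
Qed.

Lemma rsumN u : asum u -> rsum (- u) = - rsum u.
Proof.
move=> hu; apply/eqP; rewrite -addr_eq0 -rsumD //; last exact: asumN.
rewrite addNr rsum_ge0E ?esum1 //.
by apply/asumP; exists 0 => F; rewrite big1 // => x _; rewrite normr0.
Qed.

Lemma rsumB u v : asum u -> asum v -> rsum (u - v) = rsum u - rsum v.
Proof. by move=> hu hv; rewrite rsumD ?rsumN //; exact: asumN. Qed.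

Lemma rsumZ (c : R) u : asum u -> rsum (fun x => c * u x) = c * rsum u.
Proof.
have le_ge0 d p : 0 < d -> asum p -> (forall x, 0 <= p x) ->
    rsum (fun x => d * p x) <= d * rsum p.
  move=> d0 hp p0; apply: (rsum_le_bound _ _).2 => [x|F].
    by rewrite mulr_ge0 // ltW.
  by rewrite -big_distrr ler_pM2l //=; exact: fsum_le_rsum.
(* The reverse inequality is the previous one for [d^-1] and the family [d * p]. *)
have eq_ge0 d p : 0 < d -> asum p -> (forall x, 0 <= p x) ->
    rsum (fun x => d * p x) = d * rsum p.
  move=> d0 hp p0; apply/le_anti; rewrite le_ge0 //=.
  rewrite -ler_pdivlMl //; have := le_ge0 d^-1 (fun x => d * p x).
  under [X in rsum X]eq_fun do rewrite mulKf ?gt_eqF //.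
  by apply; rewrite ?invr_gt0 // ?asumZ // => x; rewrite mulr_ge0 // ltW.
have gt0 d : 0 < d -> asum u -> rsum (fun x => d * u x) = d * rsum u.
  move=> d0 hu; have hp := pos_asum hu; have hn := pos_asum (asumN hu).
  have -> : (fun x => d * u x) = (fun x => d * pos u x) - (fun x => d * pos (- u) x).
    by apply/funext => x; rewrite {1}(posB u) mulrBr.
  rewrite rsumB; try exact: asumZ.
  by rewrite !eq_ge0 // [u in RHS]posB rsumB // mulrBr.
move=> hu; have [c0|c0|->] := ltrgtP c 0; last 2 first.
- exact: gt0.
- under [X in rsum X]eq_fun do rewrite mul0r.
  rewrite mul0r rsum_ge0E ?esum1 //.
  by apply/asumP; exists 0 => F; rewrite big1 // => x _; rewrite normr0.
have := gt0 (- c); rewrite oppr_gt0 => /(_ c0 hu) h.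
rewrite -[RHS]opprK -mulNr -h -rsumN ?asumZ //; congr rsum.
by apply/funext => x; rewrite /GRing.opp /= mulNr opprK.
Qed.

Lemma rsum1 u i : (forall x, x != i -> u x = 0) -> rsum u = u i.
Proof.
move=> hu.
have ge0 p : (forall x, x != i -> p x = 0) -> 0 <= p i -> asum p /\ rsum p = p i.
  move=> hp pi0; have p0 x : 0 <= p x by case: (eqVneq x i) => [->|/hp ->].
  have [] := @rsum_le_bound p (p i) => // [F|sp le].
    have [iF|iF] := boolP (i \in F).
      rewrite (bigD1_seq i) //= ?fset_uniq // big1 ?addr0 // => x; exact: hp.
    rewrite big_seq big1 // => x xF; apply: hp; apply: contraNneq iF => <- //.
  split=> //; apply/le_anti; rewrite le /=.
  by have := fsum_le_rsum [fset i]%fset sp p0; rewrite big_seq_fset1.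
have [u0|u0] := leP 0 (u i); first by have [] := ge0 u hu u0.
have hNu x : x != i -> (- u) x = 0.
  by move=> /hu; rewrite /GRing.opp /= => ->; rewrite oppr0.
have [|h1 h2] := ge0 _ hNu; first by rewrite oppr_ge0 ltW.
by rewrite -[u]opprK rsumN // h2.
Qed.

End RealSums.

Section SquareSummable.
Variables (R : realType) (I : choiceType).
Implicit Types (f g h : I -> R).

Definition sq f := asum (fun x => f x ^+ 2).
Definition ip f g := rsum (fun x => f x * g x).

Lemma asumM f g : sq f -> sq g -> asum (fun x => f x * g x).
Proof.
move=> hf hg; apply: (asum_le _ (asumD hf hg)) => x.
rewrite /GRing.add /= ler_norml; apply/andP; split; nra.
Qed.

Lemma sqD f g : sq f -> sq g -> sq (f + g).
Proof.
move=> hf hg; apply: (asum_le _ (asumZ 2 (asumD hf hg))) => x.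
rewrite ger0_norm ?sqr_ge0 // /GRing.add /=.
by have := sqr_ge0 (f x - g x); rewrite !expr2; lra.
Qed.

Lemma sqN f : sq f -> sq (- f).
Proof. by rewrite /sq => hf; under eq_fun do rewrite {1}/GRing.opp /= sqrrN. Qed.

Lemma sqB f g : sq f -> sq g -> sq (f - g).
Proof. by move=> hf hg; apply: sqD => //; exact: sqN. Qed.

Lemma sqZ (c : R) f : sq f -> sq (fun x => c * f x).
Proof. by move=> /(asumZ (c ^+ 2)); rewrite /sq; under eq_fun do rewrite -exprMn. Qed.

Lemma sq0 : sq (0 : I -> R).
Proof.
apply/asumP; exists 0 => F; rewrite big1 // => x _.
by rewrite -[(0 : I -> R) x]/(0 : R) expr0n normr0.
Qed.

Lemma ipC f g : ip f g = ip g f.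
Proof. by rewrite /ip; under eq_fun do rewrite mulrC. Qed.

Lemma ipDl f g h : sq f -> sq g -> sq h -> ip (f + g) h = ip f h + ip g h.
Proof.
move=> hf hg hh; rewrite /ip -rsumD; try exact: asumM.
by congr rsum; apply/funext => x; rewrite -mulrDl.
Qed.

Lemma ipNl f h : sq f -> sq h -> ip (- f) h = - ip f h.
Proof.
move=> hf hh; rewrite /ip -rsumN; last exact: asumM.
by congr rsum; apply/funext => x; rewrite {2}/GRing.opp /= -mulNr.
Qed.

Lemma ipNN f g : ip (- f) (- g) = ip f g.
Proof. by rewrite /ip; congr rsum; apply/funext => x; exact: mulrNN. Qed.

Lemma ip0r f : ip f 0 = 0.
Proof.
rewrite /ip -[RHS](rsum0 R I); congr rsum.
by apply/funext => x; exact: mulr0.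
Qed.

Lemma ipZl (c : R) f h : sq f -> sq h -> ip (fun x => c * f x) h = c * ip f h.
Proof.
move=> hf hh; rewrite /ip -rsumZ; last exact: asumM.
by congr rsum; apply/funext => x; rewrite mulrA.
Qed.

Lemma ip_ge0 f : sq f -> 0 <= ip f f.
Proof. by move=> hf; apply: rsum_ge0 => [|x]; [exact: asumM|nra]. Qed.

Lemma ip_ge_fsum f (F : {fset I}) : sq f -> \sum_(x <- F) f x ^+ 2 <= ip f f.
Proof. by move=> hf; apply: fsum_le_rsum => // x; exact: sqr_ge0. Qed.

Lemma ip_ge f x : sq f -> f x ^+ 2 <= ip f f.
Proof. by move=> hf; have := ip_ge_fsum [fset x]%fset hf; rewrite big_seq_fset1. Qed.

Lemma ip_le_bound f (C : R) : (forall F : {fset I}, \sum_(x <- F) f x ^+ 2 <= C) ->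
  sq f /\ ip f f <= C.
Proof.
by move=> hC; apply: rsum_le_bound => // x; exact: sqr_ge0.
Qed.

Lemma ipE f g : ip f g = rsum (fun x => f x * g x). Proof. by []. Qed.

End SquareSummable.

Lemma discr_le (R : realType) (a b c : R) :
  (forall t, 0 <= a + 2 * t * b + t ^+ 2 * c) -> b ^+ 2 <= a * c.
Proof.
move=> h; have a0 : 0 <= a by have := h 0; rewrite mulr0 mul0r expr0n mul0r !addr0.
have [c0|c0|c0] := ltrgtP c 0.
(* A negative [c] is impossible: here [t * c < - (a + 1 + |b|)], which makes the quadratic negative
   at [2 * t]. *)
- have := h 1; have := h (-1); have := h ((a + 1 + `|b|) / - c + 1).
  set t := _ + 1; move=> ht _ _; exfalso.
  have t1 : 1 <= t by rewrite /t lerDr divr_ge0 //; have := normr_ge0 b; lra.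
  have e : (t - 1) * c = - (a + 1 + `|b|).
    by rewrite /t addrK invrN mulrN mulNr divfK // lt_eqF.
  have b1 := ler_norm b; have nb := normr_ge0 b.
  have h2 := h (2 * t); have := h t; nra.
- have cn0 : c != 0 by rewrite gt_eqF.
  have := h (- b / c).
  have -> : a + 2 * (- b / c) * b + (- b / c) ^+ 2 * c = (a * c - b ^+ 2) / c.
    by field.
  by rewrite pmulr_lge0 ?invr_gt0 // subr_ge0.
- have [->|b0] := eqVneq b 0; first by rewrite expr0n mulr_ge0 // c0.
  have := h (- (a + 1) / (2 * b)).
  have -> : a + 2 * (- (a + 1) / (2 * b)) * b + (- (a + 1) / (2 * b)) ^+ 2 * c
    = - 1 by rewrite c0; field.
  by rewrite oppr_ge0 ler10.
Qed.

Lemma norm_le_sqr (R : realType) (x e : R) :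
  0 <= e -> x ^+ 2 <= e ^+ 2 -> `|x| <= e.
Proof.
move=> e0 h; rewrite -(ger0_norm e0) -!sqrtr_sqr ler_sqrt //; exact: sqr_ge0.
Qed.

Lemma sqE (R : realType) (I : choiceType) (f : I -> R) :
  sq f = asum (fun x => f x ^+ 2).
Proof. by []. Qed.

Lemma cvgn_sum (R : realType) (J : Type) (s : seq J) (u : J -> nat -> R)
    (l : J -> R) : (forall j, (u j n @[n --> \oo] --> l j)%classic) ->
  ((fun n => \sum_(j <- s) u j n) @ \oo --> \sum_(j <- s) l j)%classic.
Proof.
move=> h; elim: s => [|x s IH].
  by under eq_fun do rewrite big_nil; rewrite big_nil; exact: cvg_cst.
by under eq_fun do rewrite big_cons; rewrite big_cons; apply: cvgD.
Qed.

Opaque sq ip.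

(** * Tuples of square-summable families: completeness and monotone limits of projections *)

Section Vectors.
Variables (R : realType) (I : choiceType) (k : nat).
Implicit Types (v w z : 'I_k -> I -> R).

Definition sqk v := forall i, sq (v i).
Definition ipk v w := \sum_i ip (v i) (w i).

Lemma sqkB v w : sqk v -> sqk w -> sqk (v - w).
Proof. by move=> hv hw i; exact: sqB. Qed.

Lemma sqkD v w : sqk v -> sqk w -> sqk (v + w).
Proof. by move=> hv hw i; exact: sqD. Qed.

Lemma ipkC v w : ipk v w = ipk w v.
Proof. by apply: eq_bigr => i _; exact: ipC. Qed.

Lemma ipkDl v w z : sqk v -> sqk w -> sqk z -> ipk (v + w) z = ipk v z + ipk w z.
Proof.
by move=> hv hw hz; rewrite /ipk -big_split /=; apply: eq_bigr => i _; exact: ipDl.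
Qed.

Lemma ipkBl v w z : sqk v -> sqk w -> sqk z -> ipk (v - w) z = ipk v z - ipk w z.
Proof.
move=> hv hw hz; rewrite ipkDl //; last by move=> i; exact: sqN.
by congr (_ + _); rewrite /ipk -sumrN; apply: eq_bigr => i _; exact: ipNl.
Qed.

Lemma ipkBr v w z : sqk v -> sqk w -> sqk z -> ipk z (v - w) = ipk z v - ipk z w.
Proof. by move=> hv hw hz; rewrite !(ipkC z) ipkBl. Qed.

Lemma ipkZl (c : R) v z : sqk v -> sqk z ->
  ipk (fun i x => c * v i x) z = c * ipk v z.
Proof.
by move=> hv hz; rewrite /ipk big_distrr; apply: eq_bigr => i _; exact: ipZl.
Qed.

Lemma ipk_ge0 v : sqk v -> 0 <= ipk v v.
Proof. by move=> hv; apply: sumr_ge0 => i _; exact: ip_ge0. Qed.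

Lemma ipk_ge_ip v i : sqk v -> ip (v i) (v i) <= ipk v v.
Proof.
move=> hv; rewrite /ipk (bigD1 i) //= lerDl.
by apply: sumr_ge0 => j _; exact: ip_ge0.
Qed.

Lemma ipk_ge v i x : sqk v -> v i x ^+ 2 <= ipk v v.
Proof. by move=> hv; apply: le_trans (ipk_ge_ip i hv); exact: ip_ge. Qed.

Lemma ipk_eq0 v : sqk v -> ipk v v = 0 -> v = 0.
Proof.
move=> hv e; apply/funext => i; apply/funext => x; apply/eqP.
rewrite -[_ == _]sqrf_eq0 eq_le sqr_ge0 andbT -[X in _ <= X]e.
exact: ipk_ge.
Qed.

Lemma cauchy_schwarz v w : sqk v -> sqk w ->
  ipk v w ^+ 2 <= ipk v v * ipk w w.
Proof.
move=> hv hw; apply: discr_le => t.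
have htw : sqk (fun i x => t * w i x) by move=> i; exact: sqZ.
have := ipk_ge0 (sqkD hv htw); rewrite ipkDl //; last exact: sqkD.
rewrite !(ipkC _ (v + _)) !ipkDl // ipkZl // !(ipkC _ (fun i x => t * w i x)).
rewrite !ipkZl // (ipkC w v) (ipkC w (fun i x => t * w i x)) ipkZl //.
by congr (0 <= _); ring.
Qed.

Lemma ipkE v w : ipk v w = \sum_i ip (v i) (w i). Proof. by []. Qed.

Opaque ipk.

Definition tends (v : nat -> 'I_k -> I -> R) w :=
  forall e, 0 < e -> exists N0, forall N, (N0 <= N)%N ->
    ipk (v N - w) (v N - w) <= e.

Lemma tends_ipk (v : nat -> 'I_k -> I -> R) w z :
  (forall n, sqk (v n)) -> sqk w -> sqk z -> tends v w ->
  ((fun n => ipk (v n) z) @ \oo --> ipk w z)%classic.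
Proof.
move=> hv hw hz ht; apply/cvgrPdist_le => e e0.
have c0 : 0 < ipk z z + 1 by rewrite ltr_wpDl // ipk_ge0.
have [|N0 hN] := ht (e ^+ 2 / (ipk z z + 1)); first by rewrite divr_gt0 ?exprn_gt0.
exists N0 => // N /= /hN le; rewrite distrC -ipkBl //.
apply: norm_le_sqr; first exact: ltW.
apply: le_trans (cauchy_schwarz (sqkB (hv N) hw) hz) _.
have zz := ipk_ge0 hz; apply: le_trans (ler_wpM2r zz le) _.
by rewrite mulrAC ler_pdivrMr // ler_pM2l ?exprn_gt0 // lerDl.
Qed.

Lemma tends_pointwise (v : nat -> 'I_k -> I -> R) w i x :
  (forall n, sqk (v n)) -> sqk w -> tends v w ->
  ((fun n => v n i x) @ \oo --> w i x)%classic.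
Proof.
move=> hv hw ht; apply/cvgrPdist_le => e e0.
have [|N0 hN] := ht (e ^+ 2); first by rewrite exprn_gt0.
exists N0 => // N /= /hN le; rewrite distrC.
apply: norm_le_sqr; first exact: ltW.
by apply: le_trans le; apply: (ipk_ge i x (sqkB (hv N) hw)).
Qed.

(** Completeness of l^2. The limit exists pointwise, and its distance to [v m] is bounded over each
    finite set [F], where the limit may be taken inside the sum. *)
Lemma vectors_complete (v : nat -> 'I_k -> I -> R) :
  (forall n, sqk (v n)) ->
  (forall e, 0 < e -> exists N0, forall m n, (N0 <= m)%N -> (N0 <= n)%N ->
    ipk (v m - v n) (v m - v n) <= e) ->
  exists2 w, sqk w & tends v w.
Proof.
move=> hv hc.
have cvgv i x : cvg ((fun n => v n i x) @ \oo)%classic.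
  apply/cauchy_cvgP/cauchyP => e e0.
  have [|N0 hN] := hc ((e / 2) ^+ 2); first by rewrite exprn_gt0 // divr_gt0.
  exists (v N0 i x); exists N0 => // n /= n0; rewrite -ball_normE /=.
  have h : `|v N0 i x - v n i x| <= e / 2.
    apply: norm_le_sqr; first by rewrite divr_ge0 // ltW.
    by apply: le_trans (hN N0 n (leqnn _) n0);
      apply: (ipk_ge i x (sqkB (hv _) (hv _))).
  by apply: le_lt_trans h _; lra.
pose w := (fun i x => limn (fun n => v n i x)) : 'I_k -> I -> R.
have cvgF i (F : {fset I}) m :
    ((fun n => \sum_(x <- F) (v m i x - v n i x) ^+ 2) @ \oo -->
      \sum_(x <- F) (v m i x - w i x) ^+ 2)%classic.
  apply: cvgn_sum => x; rewrite expr2; under eq_fun do rewrite expr2.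
  by apply: cvgM; apply: cvgB => //; exact: cvg_cst.
have bound e N0 m i : (forall m n, (N0 <= m)%N -> (N0 <= n)%N ->
    ipk (v m - v n) (v m - v n) <= e) -> (N0 <= m)%N ->
    sq (v m i - w i) /\ ip (v m i - w i) (v m i - w i) <= e.
  move=> h m0; apply: ip_le_bound => F.
  apply: (cvgr_to_le (cvgF i F m)); exists N0 => // n /= n0.
  apply: le_trans (h m n m0 n0); apply: le_trans (ipk_ge_ip i (sqkB (hv _) (hv _))).
  exact: (ip_ge_fsum F (sqB (hv _ i) (hv _ i))).
have sqw : sqk w.
  move=> i; have [N0 hN] := hc 1 ltr01.
  have [h _] := bound 1 N0 N0 i hN (leqnn _).
  by have := sqB (hv N0 i) h; rewrite opprB addrC subrK.
exists w => // e e0.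
(* Dividing by [k.+1] rather than [k] covers the case of no components. *)
have [|N0 hN] := hc (e / k.+1%:R); first by rewrite divr_gt0.
exists N0 => N n0; rewrite ipkE.
apply: (@le_trans _ _ (\sum_(i < k) e / k.+1%:R)).
  by apply: ler_sum => i _; have [] := bound _ N0 N i hN n0.
rewrite sumr_const card_ord -[X in X <= _]mulr_natr mulrAC ler_pdivrMr //.
by rewrite ler_pM2l // ler_nat.
Qed.

Variables (Q : nat -> ('I_k -> I -> R) -> 'I_k -> I -> R).
Variable K : ('I_k -> I -> R) -> Prop.
Hypothesis Qsq : forall N v, sqk v -> sqk (Q N v).
Hypothesis Qadj : forall N v w, sqk v -> sqk w -> ipk (Q N v) w = ipk v (Q N w).
Hypothesis Qmono : forall M N v, (M <= N)%N -> sqk v -> Q N (Q M v) = Q M v.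

(** The numbers [a N] increase and are bounded by the squared norm of [v], and their differences are
    the squared distances between the [Q N v]. So convergence of the numbers makes the vectors a
    Cauchy sequence. *)
Lemma monotone_proj_cvg v : sqk v -> exists2 w, sqk w & tends (Q^~ v) w.
Proof.
move=> hv; pose a N := ipk (Q N v) v.
have ipQ M N : (M <= N)%N -> ipk (Q N v) (Q M v) = a M.
  by move=> le; rewrite Qadj ?Qmono // ?(ipkC v) //; exact: Qsq.
have dist M N : (M <= N)%N -> ipk (Q N v - Q M v) (Q N v - Q M v) = a N - a M.
  move=> le; have sN := Qsq N hv; have sM := Qsq M hv; have sB := sqkB sN sM.
  rewrite (ipkBl sN sM sB) (ipkBr sN sM sN) (ipkBr sN sM sM) (ipkC (Q M v)).
  by rewrite (ipQ N N (leqnn N)) (ipQ M N le) (ipQ M M (leqnn M)) subrr subr0.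
have homo : {homo a : n m / (n <= m)%N >-> n <= m}.
  move=> M N le; rewrite -subr_ge0 -(dist _ _ le).
  exact: ipk_ge0 (sqkB (Qsq N hv) (Qsq M hv)).
have ub : has_ubound (range a).
  exists (ipk v v) => _ [N _ <-]; rewrite -subr_ge0.
  have sN := Qsq N hv; have sB := sqkB hv sN; have := ipk_ge0 sB.
  rewrite (ipkBl hv sN sB) (ipkBr hv sN hv) (ipkBr hv sN sN).
  by rewrite (ipQ N N (leqnn N)) (ipkC v) /a subrr subr0.
have cv := nondecreasing_is_cvgn homo ub.
apply: vectors_complete => [n|e e0]; first exact: Qsq.
have /cvgrPdist_le /(_ (e / 2)) := cv; rewrite divr_gt0 // => /(_ isT) [N0 _ hN].
exists N0.
have key m n : (N0 <= m)%N -> (N0 <= n)%N -> (m <= n)%N -> a n - a m <= e.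
  move=> hm hn _; have := hN m hm; have := hN n hn; rewrite /= !ler_norml.
  by move=> /andP[? ?] /andP[? ?]; lra.
move=> m n hm hn; have [le|/ltnW le] := leqP n m; first by rewrite (dist _ _ le);
  exact: key.
have -> : Q m v - Q n v = - (Q n v - Q m v) by rewrite opprB.
have sB := sqkB (Qsq n hv) (Qsq m hv).
have -> : ipk (- (Q n v - Q m v)) (- (Q n v - Q m v)) =
          ipk (Q n v - Q m v) (Q n v - Q m v).
  rewrite !ipkE; apply: eq_bigr => i _; exact: ipNN.
by rewrite (dist _ _ le); exact: key.
Qed.

Hypothesis KB : forall v w, K v -> K w -> K (v - w).
Hypothesis Kclosed : forall (v : nat -> 'I_k -> I -> R) w,
  (forall n, sqk (v n)) -> sqk w -> tends v w -> (forall n, K (v n)) -> K w.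
Hypothesis KQ : forall N v, sqk v -> K (Q N v).
Hypothesis K0 : forall w, sqk w -> K w -> (forall N, Q N w = 0) -> w = 0.

(** The limit [P] projects onto all of [K] because only 0 in [K] is killed by every [Q N]: applied
    to [w - P w], this shows that [P] fixes each [w] in [K]. *)
Lemma monotone_proj_orth : exists P : ('I_k -> I -> R) -> 'I_k -> I -> R,
  forall v, sqk v -> [/\ sqk (P v), K (P v), tends (Q^~ v) (P v) &
    forall w, sqk w -> K w -> ipk (v - P v) w = 0].
Proof.
have ex v : exists w, sqk v -> sqk w /\ tends (Q^~ v) w.
  have [hv|nv] := pselect (sqk v); last by exists 0.
  by have [w h1 h2] := monotone_proj_cvg hv; exists w.
have [P hP] := choice ex; exists P => v hv; have [sP tP] := hP v hv.
(* [Q N] is self-adjoint and its range is fixed by all later [Q M], so pairing with [Q N y] cannot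
   distinguish [u] from the limit [P u]. *)
have res u : sqk u -> forall N, Q N (u - P u) = 0.
  move=> hu N; have [sPu tPu] := hP u hu; have sB := sqkB hu sPu.
  set y := Q N _; have sy : sqk y by exact: Qsq.
  apply: (ipk_eq0 sy); rewrite {1}/y (Qadj _ sB sy).
  have sQy := Qsq N sy; rewrite (ipkBl hu sPu sQy).
  suff -> : ipk (P u) (Q N y) = ipk u (Q N y) by rewrite subrr.
  have /(_ (Q N y)) c1 := tends_ipk (fun n => Qsq n hu) sPu _ tPu.
  apply: (@cvg_unique _ _ _ _ _ _ (c1 sQy)) => //.
  apply: cvg_near_cst; exists N => // M /= le.
  by rewrite (Qadj _ hu sQy) (Qmono le sy).
split=> //.
  by apply: (Kclosed (fun n => Qsq n hv) sP tP) => n; exact: KQ.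
move=> w sw Kw; have [sPw tPw] := hP w sw.
have KPw : K (P w).
  by apply: (Kclosed (fun n => Qsq n sw) sPw tPw) => n; exact: KQ.
have ew : w = P w.
  apply/eqP; rewrite -subr_eq0; apply/eqP; apply: K0; [exact: sqkB|exact: KB|].
  exact: res.
have sB := sqkB hv sP; rewrite ew ipkC.
have c1 := tends_ipk (fun n => Qsq n sw) sPw sB tPw.
apply: (@cvg_unique _ _ _ _ _ _ c1) => //.
apply: cvg_near_cst; exists 0 => // M _ /=.
rewrite (Qadj _ sw sB) (res v hv M) ipkE big1 // => i _; exact: ip0r.
Qed.

End Vectors.

(** * Kernels of matrices over the group ring *)

Section GroupActionL2.
Variables (R : realType) (G : groupType).
Implicit Types (a b : group_ring G) (f h : G -> R).

Definition ltrans (g x : G) : G := (g * x)%g.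

Lemma ltrans_bij (g : G) : bijective (ltrans g).
Proof. by exists (ltrans g^-1%g) => x; rewrite /ltrans ?mulKg ?mulVKg. Qed.

Lemma rconv_monE c g f :
  rconv (mon c g) f = (fun x => ratr c * (f \o ltrans g^-1%g) x).
Proof. by apply/funext => x; rewrite rconv_mon. Qed.

Lemma sq_translate g f : sq f -> sq (f \o ltrans g).
Proof. by rewrite !sqE => /(asum_reindex (ltrans_bij g)). Qed.

Lemma sq_rconv a f : sq f -> sq (rconv a f).
Proof.
move=> hf; elim/gr_ind: a => [|c g|a1 a2 h1 h2].
- by rewrite rconv0l; exact: sq0.
- by rewrite rconv_monE; apply: sqZ; exact: sq_translate.
- by rewrite rconvDl; exact: sqD.
Qed.

Lemma ip0l f : ip (0 : G -> R) f = 0. Proof. by rewrite ipC ip0r. Qed.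

Lemma ip_rconv a f h : sq f -> sq h -> ip (rconv a f) h = ip f (rconv (gr_star a) h).
Proof.
move=> hf hh; elim/gr_ind: a => [|c g|a1 a2 h1 h2].
- by rewrite raddf0 !rconv0l ip0l ip0r.
- rewrite star_mon !rconv_monE invgK (ipZl _ (sq_translate _ hf) hh).
  rewrite (ipC f) (ipZl _ (sq_translate _ hh) hf) (ipC _ f); congr (_ * _).
  rewrite !ipE -(rsum_reindex _ (ltrans_bij g)); congr rsum.
  by apply/funext => x; rewrite /= /ltrans mulKg.
- rewrite raddfD !rconvDl (ipDl (sq_rconv _ hf) (sq_rconv _ hf) hh) h1 h2.
  rewrite (ipC f (_ + _)) (ipDl (sq_rconv _ hh) (sq_rconv _ hh) hf).
  by rewrite !(ipC f).
Qed.

Lemma sq_delta (x : G) : sq (delta R x).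
Proof.
rewrite sqE; apply: (@rsum_le_bound R G _ 1 _ _).1 => [y|F]; first exact: sqr_ge0.
 rewrite (eq_bigr (fun y => (y == x)%:R)); last first.
  by move=> y _; rewrite /delta; case: eqP => _; rewrite ?expr1n ?expr0n.
have [xF|xF] := boolP (x \in F).
  by rewrite (bigD1_seq x) //= ?fset_uniq // eqxx big1 ?addr0 // => y /negbTE ->.
rewrite big_seq big1 // => y yF.
by case: eqP => // e; move: xF; rewrite -e yF.
Qed.

Lemma ip_delta f x : ip f (delta R x) = f x.
Proof.
rewrite ipE (@rsum1 _ _ _ x) => [|y /negbTE yx]; rewrite /delta ?eqxx ?mulr1 //.
by rewrite yx mulr0.
Qed.

Lemma rconv_delta_coef a x y : rconv a (delta R x) y = ratr a@_(y * x^-1)%g.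
Proof.
elim/gr_ind: a => [|c g|a1 a2 h1 h2]; first by rewrite rconv0l coef0 rmorph0.
  rewrite rconv_mon coef_mon /delta.
  rewrite -(inj_eq (mulgI g)) mulVKg -divg_eq eq_sym.
  by case: eqP => _; rewrite ?mulr1 ?mulr0 ?mulr1n ?mulr0n ?rmorph0.
by rewrite rconvDl {1}/GRing.add /= h1 h2 coefD rmorphD.
Qed.

Lemma ip_cauchy_schwarz f h : sq f -> sq h -> ip f h ^+ 2 <= ip f f * ip h h.
Proof.
move=> hf hh.
have := @cauchy_schwarz R G 1 (fun=> f) (fun=> h) (fun=> hf) (fun=> hh).
by rewrite !ipkE !big_ord1.
Qed.

(** The value at [x] is the pairing of [f] with [a] applied to [delta x], whose squared norm is the
    trace of [a]. Hence projections of small trace have uniformly small values. *)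
Lemma proj_pointwise_le a f x : sq f -> gr_star a = a -> a * a = a ->
  rconv a f x ^+ 2 <= ip f f * ratr a@_1%g.
Proof.
move=> hf sa aa; rewrite -ip_delta (ip_rconv _ hf (sq_delta x)) sa.
apply: le_trans (ip_cauchy_schwarz hf (sq_rconv _ (sq_delta x))) _.
rewrite (ip_rconv _ (sq_delta x) (sq_rconv _ (sq_delta x))) sa -rconvM aa.
by rewrite ipC ip_delta rconv_delta_coef mulgV.
Qed.

Lemma rconvMn a n f x : rconv (a *+ n) f x = n%:R * rconv a f x.
Proof.
elim: n => [|n IH]; first by rewrite mulr0n rconv0l mul0r.
by rewrite mulrSr rconvDl {1}/GRing.add /= IH -natr1 mulrDl mul1r.
Qed.

End GroupActionL2.

Section MatrixAction.
Variables (R : realType) (G : groupType) (k : nat).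
Implicit Types (T S : 'M[group_ring G]_k) (v w : 'I_k -> G -> R).

Definition mxactR T v : 'I_k -> G -> R := fun i => \sum_j rconv (T i j) (v j).

Lemma sq_sum (I : Type) (s : seq I) (P : pred I) (F : I -> G -> R) :
  (forall i, P i -> sq (F i)) -> sq (\sum_(i <- s | P i) F i).
Proof. by move=> h; apply: (big_ind (fun f => sq f)) => //;
  [exact: sq0|exact: sqD]. Qed.

Lemma sqk_mxactR T v : sqk v -> sqk (mxactR T v).
Proof. by move=> hv i; apply: sq_sum => j _; exact: sq_rconv. Qed.

Lemma ip_suml (I : Type) (s : seq I) (P : pred I) (F : I -> G -> R) (h : G -> R) :
  (forall i, P i -> sq (F i)) -> sq h ->
  ip (\sum_(i <- s | P i) F i) h = \sum_(i <- s | P i) ip (F i) h.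
Proof.
move=> hF hh; suff [] : sq (\sum_(i <- s | P i) F i) /\
  ip (\sum_(i <- s | P i) F i) h = \sum_(i <- s | P i) ip (F i) h by [].
apply: (big_ind2 (fun f r => sq f /\ ip f h = r)).
- by split; [exact: sq0|exact: ip0l].
- move=> f1 r1 f2 r2 [s1 <-] [s2 <-]; split; first exact: sqD.
  exact: ipDl.
- by move=> i Pi; split=> //; exact: hF.
Qed.

Lemma ipk_mxactR T v w : sqk v -> sqk w ->
  ipk (mxactR T v) w = ipk v (mxactR (adjmx T) w).
Proof.
move=> hv hw; rewrite !ipkE.
transitivity (\sum_i \sum_j ip (rconv (T i j) (v j)) (w i)).
  apply: eq_bigr => i _; apply: ip_suml => // j _; exact: sq_rconv.
rewrite exchange_big /=; apply: eq_bigr => j _.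
rewrite ipC ip_suml //; last by move=> i _; exact: sq_rconv.
by apply: eq_bigr => i _; rewrite mxE ipC (ipC _ (v j)) -ip_rconv // ipC.
Qed.

Lemma mxactRM S T v : mxactR (S *m T) v = mxactR S (mxactR T v).
Proof.
apply/funext => i; rewrite /mxactR.
transitivity (\sum_j \sum_l rconv (S i l) (rconv (T l j) (v j))).
  by apply: eq_bigr => j _; rewrite mxE rconv_suml; under eq_bigr do rewrite rconvM.
by rewrite exchange_big; apply: eq_bigr => l _ /=; rewrite raddf_sum.
Qed.

Lemma mxactRD S T v : mxactR (S + T) v = mxactR S v + mxactR T v.
Proof.
apply/funext => i; rewrite -[RHS]/(mxactR S v i + mxactR T v i) /mxactR -big_split.
by apply: eq_bigr => j _; rewrite mxE rconvDl.
Qed.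

Lemma adjmxK T : adjmx (adjmx T) = T.
Proof. by apply/matrixP => i j; rewrite !mxE starK. Qed.

Lemma ipk_adjmxM T v : sqk v ->
  ipk (mxactR (adjmx T *m T) v) v = ipk (mxactR T v) (mxactR T v).
Proof.
move=> hv; rewrite mxactRM (ipk_mxactR _ (sqk_mxactR T hv) hv) adjmxK //.
Qed.

Lemma ipk0l v : ipk (0 : 'I_k -> G -> R) v = 0.
Proof. by rewrite ipkE big1 // => i _; exact: ip0l. Qed.

Lemma mxactR0 T : mxactR T (0 : 'I_k -> G -> R) = 0.
Proof. by apply/funext => i; rewrite /mxactR big1 // => j _; exact: raddf0. Qed.

Lemma ker_adjmxM T v : sqk v -> mxactR (adjmx T *m T) v = 0 <-> mxactR T v = 0.
Proof.
move=> hv; split=> h; last by rewrite mxactRM h mxactR0.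
by apply: (ipk_eq0 (sqk_mxactR T hv)); rewrite -ipk_adjmxM // h ipk0l.
Qed.

(** Pairing with [v] gives a sum of two squared norms. This merges two systems of equations into the
    kernel of one matrix. *)
Lemma ker_adjmxM_add S T v : sqk v ->
  mxactR (adjmx S *m S + adjmx T *m T) v = 0 <->
  mxactR S v = 0 /\ mxactR T v = 0.
Proof.
move=> hv; split=> [h|[hS hT]]; last by rewrite mxactRD !mxactRM hS hT !mxactR0 addr0.
have hS := sqk_mxactR (adjmx S *m S) hv; have hT := sqk_mxactR (adjmx T *m T) hv.
have e : ipk (mxactR S v) (mxactR S v) + ipk (mxactR T v) (mxactR T v) = 0.
  by rewrite -!ipk_adjmxM // -(ipkDl hS hT hv) -mxactRD h ipk0l.
have pS := ipk_ge0 (sqk_mxactR S hv); have pT := ipk_ge0 (sqk_mxactR T hv).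
by split; apply: ipk_eq0; rewrite ?[LHS]/(0 : R); try exact: sqk_mxactR;
  apply/eqP; rewrite eq_le; apply/andP; split=> //; lra.
Qed.

Lemma mxactRB T v w : mxactR T (v - w) = mxactR T v - mxactR T w.
Proof.
apply/funext => i; rewrite -[RHS]/(mxactR T v i - mxactR T w i) /mxactR -sumrB.
by apply: eq_bigr => j _; rewrite raddfB.
Qed.

End MatrixAction.

(** * Complex vectors through their real and imaginary parts *)

Lemma Re_mulJ (R : realType) (z w : R[i]) : complex.Re (z * w^*) =
  complex.Re z * complex.Re w + complex.Im z * complex.Im w.
Proof. by case: z w => a b [c d] /=; rewrite mulrN opprK. Qed.

Lemma Im_mulJ (R : realType) (z w : R[i]) : complex.Im (z * w^*) =
  complex.Im z * complex.Re w - complex.Re z * complex.Im w.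
Proof. by case: z w => a b [c d] /=; rewrite mulrN addrC. Qed.

Section ComplexReduction.
Variables (R : realType) (G : groupType) (k : nat).
Implicit Types (v w : 'I_k -> G -> R[i]) (f h : G -> R[i]).

Definition cRe v : 'I_k -> G -> R := fun i x => complex.Re (v i x).
Definition cIm v : 'I_k -> G -> R := fun i x => complex.Im (v i x).

Lemma l2P f : l2 f <->
  sq (fun x => complex.Re (f x)) /\ sq (fun x => complex.Im (f x)).
Proof.
have e : l2 f = asum (fun x => complex.Re (f x) ^+ 2 + complex.Im (f x) ^+ 2).
  rewrite asumE /l2 /mkset; congr (is_true (_ < _)%E).
  apply: eq_esum => x _; rewrite -add_Re2_Im2 /= ger0_norm //.
  by rewrite addr_ge0 // sqr_ge0.
rewrite e !sqE; split=> [h|[h1 h2]]; last exact: asumD h1 h2.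
by split; apply: asum_le h => x; rewrite ger0_norm ?sqr_ge0 // ?lerDl ?lerDr sqr_ge0.
Qed.

Lemma l2powP v : l2pow v <-> sqk (cRe v) /\ sqk (cIm v).
Proof.
split=> [h|[h1 h2] i]; last by apply/l2P; split; [exact: h1|exact: h2].
by split=> i; have /l2P[] := h i.
Qed.

Lemma innerE f h : l2 f -> l2 h -> inner f h = Complex
  (ip (fun x => complex.Re (f x)) (fun x => complex.Re (h x))
   + ip (fun x => complex.Im (f x)) (fun x => complex.Im (h x)))
  (ip (fun x => complex.Im (f x)) (fun x => complex.Re (h x))
   - ip (fun x => complex.Re (f x)) (fun x => complex.Im (h x))).
Proof.
move=> /l2P[fr fi] /l2P[hr hi]; rewrite /inner /csum !ipE; congr Complex.
  rewrite -(rsumD (asumM fr hr) (asumM fi hi)); congr rsum; apply/funext => x.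
  exact: Re_mulJ.
rewrite -(rsumB (asumM fi hr) (asumM fr hi)); congr rsum; apply/funext => x.
exact: Im_mulJ.
Qed.

Lemma inner_powE v w : l2pow v -> l2pow w -> inner_pow v w = Complex
  (ipk (cRe v) (cRe w) + ipk (cIm v) (cIm w))
  (ipk (cIm v) (cRe w) - ipk (cRe v) (cIm w)).
Proof.
move=> hv hw; rewrite /inner_pow !ipkE -big_split -sumrB /=.
rewrite (eq_bigr _ (fun i _ => innerE (hv i) (hw i))).
by elim/big_rec3: _ => [|i a b c _ ->].
Qed.

Lemma ratr_complex (q : rat) : ratr q = (ratr q)%:C%C :> R[i].
Proof. by rewrite -(fmorph_rat (real_complex R)). Qed.

Lemma Re_sum (I : Type) (s : seq I) (F : I -> R[i]) :
  complex.Re (\sum_(i <- s) F i) = \sum_(i <- s) complex.Re (F i).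
Proof. by apply: (big_morph (@complex.Re R)) => // -[a b] [c d]. Qed.

Lemma Im_sum (I : Type) (s : seq I) (F : I -> R[i]) :
  complex.Im (\sum_(i <- s) F i) = \sum_(i <- s) complex.Im (F i).
Proof. by apply: (big_morph (@complex.Im R)) => // -[a b] [c d]. Qed.

Lemma cRe_mxact (T : 'M[group_ring G]_k) v : cRe (mxact T v) = mxactR T (cRe v).
Proof.
apply/funext => i; apply/funext => x; rewrite /cRe /mxact /mxactR fct_sumE Re_sum.
apply: eq_bigr => j _; rewrite /conv /rconv Re_sum; apply: eq_bigr => g _.
by rewrite ratr_complex; case: (v j _) => a b /=; rewrite mul0r subr0.
Qed.

Lemma cIm_mxact (T : 'M[group_ring G]_k) v : cIm (mxact T v) = mxactR T (cIm v).
Proof.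
apply/funext => i; apply/funext => x; rewrite /cIm /mxact /mxactR fct_sumE Im_sum.
apply: eq_bigr => j _; rewrite /conv /rconv Im_sum; apply: eq_bigr => g _.
by rewrite ratr_complex; case: (v j _) => a b /=; rewrite mul0r addr0.
Qed.

Lemma l2kerP (T : 'M[group_ring G]_k) v : l2ker T v <->
  [/\ l2pow v, mxactR T (cRe v) = 0 & mxactR T (cIm v) = 0].
Proof.
split=> [[h e]|[h e1 e2]].
  split=> //; rewrite -?cRe_mxact -?cIm_mxact; apply/funext => i; apply/funext => x;
  by rewrite /cRe /cIm e.
split=> // i x; apply/eqP; rewrite eq_complex; apply/andP; split; apply/eqP.
  by rewrite -[LHS]/(cRe (mxact T v) i x) cRe_mxact e1.
by rewrite -[LHS]/(cIm (mxact T v) i x) cIm_mxact e2.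
Qed.

Definition zetaR (i : 'I_k) : 'I_k -> G -> R :=
  fun j => if j == i then delta R 1%g else 0.

Lemma sqk_zetaR i : sqk (zetaR i).
Proof. by move=> j; rewrite /zetaR; case: eqP => _; [exact: sq_delta|exact: sq0]. Qed.

Lemma cRe_zeta i : cRe (@zeta R G k i) = zetaR i.
Proof.
apply/funext => j; apply/funext => x; rewrite /cRe /zeta /zetaR /delta.
by case: (j == i); case: (x == 1%g).
Qed.

Lemma cIm_zeta i : cIm (@zeta R G k i) = 0.
Proof.
by apply/funext => j; apply/funext => x; rewrite /cIm /zeta; case: (_ && _).
Qed.

Lemma ipk_zetaR (u : 'I_k -> G -> R) i : ipk u (zetaR i) = u i 1%g.
Proof.
rewrite ipkE (bigD1 i) //= big1 => [|j /negbTE ji]; rewrite /zetaR.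
  by rewrite eqxx ip_delta addr0.
by rewrite ji ip0r.
Qed.

End ComplexReduction.

(** * The dimension of a kernel as a limit of traces *)

Section KernelDimension.
Variables (R : realType) (G : groupType) (k : nat).
Implicit Types v w : 'I_k -> G -> R.
Variable T : 'M[group_ring G]_k.
Variable Q : nat -> ('I_k -> G -> R) -> 'I_k -> G -> R.
Hypothesis Qsq : forall N v, sqk v -> sqk (Q N v).
Hypothesis Qadj : forall N v w, sqk v -> sqk w -> ipk (Q N v) w = ipk v (Q N w).
Hypothesis Qmono : forall M N v, (M <= N)%N -> sqk v -> Q N (Q M v) = Q M v.
Hypothesis QT : forall N v, sqk v -> mxactR T (Q N v) = 0.
Hypothesis Qker :
  forall w, sqk w -> mxactR T w = 0 -> (forall N, Q N w = 0) -> w = 0.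

(** Norm convergence implies convergence of the values at the neutral element, which are the
    summands of the trace; so the trace passes from the [Q N] to the projection onto the kernel. *)
Lemma is_dim_ker_lim (r : R) :
  ((fun N => \sum_i Q N (zetaR R i) i 1%g) @ \oo --> r)%classic -> is_dim_ker T r.
Proof.
move=> hr.
pose K (u : 'I_k -> G -> R) := mxactR T u = 0.
have KB u u' : K u -> K u' -> K (u - u').
  by rewrite /K mxactRB => -> ->; rewrite subrr.
have Kclosed (u : nat -> 'I_k -> G -> R) w : (forall n, sqk (u n)) -> sqk w ->
    tends u w -> (forall n, K (u n)) -> K w.
  move=> hu hw tu Ku; apply: (ipk_eq0 (sqk_mxactR T hw)).
  have sT := sqk_mxactR T hw; have sTT := sqk_mxactR (adjmx T) sT.
  rewrite (ipk_mxactR _ hw sT).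
  apply: (@cvg_unique _ _ _ _ _ _ (tends_ipk hu hw sTT tu)) => //.
  apply: cvg_near_cst; exists 0 => // n _ /=.
  by rewrite -(ipk_mxactR _ (hu n) sT) (Ku n) ipk0l.
have [P hP] := monotone_proj_orth Qsq Qadj Qmono KB Kclosed QT Qker.
(* As [T] has rational coefficients, its complex kernel is the complexification of the real one, and
   the projection acts separately on real and imaginary parts. *)
pose PC (v : 'I_k -> G -> R[i]) : 'I_k -> G -> R[i] := fun i x => Complex (P (cRe v)
  i x) (P (cIm v) i x).
have ePr (v : 'I_k -> G -> R[i]) : cRe (PC v) = P (cRe v) by [].
have ePi (v : 'I_k -> G -> R[i]) : cIm (PC v) = P (cIm v) by [].
have kerE (v : 'I_k -> G -> R[i]) : l2ker (adjmx T *m T) v <->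
    [/\ l2pow v, K (cRe v) & K (cIm v)].
  rewrite l2kerP; split=> [[/[dup] h /l2powP[h1 h2]]|[/[dup] h /l2powP[h1 h2]]].
    by rewrite !ker_adjmxM // => *; split.
  by move=> *; split=> //; rewrite ker_adjmxM.
exists PC.
  move=> v /[dup] hv /l2powP[hr1 hi1].
  have [sr Kr _ or] := hP _ hr1; have [si Ki _ oi] := hP _ hi1.
  have lP : l2pow (PC v) by apply/l2powP.
  split; first by apply/kerE.
  move=> w /kerE[/[dup] hw /l2powP[wr wi] Kwr Kwi].
  have eR : cRe (fun i x => v i x - PC v i x) = cRe v - P (cRe v).
    apply/funext => i; apply/funext => x; rewrite -ePr.
    by rewrite -[RHS]/(cRe v i x - cRe (PC v) i x) /cRe; case: (v i x);
      case: (PC v i x).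
  have eI : cIm (fun i x => v i x - PC v i x) = cIm v - P (cIm v).
    apply/funext => i; apply/funext => x; rewrite -ePi.
    by rewrite -[RHS]/(cIm v i x - cIm (PC v) i x) /cIm; case: (v i x);
      case: (PC v i x).
  rewrite inner_powE //; last first.
    by apply/l2powP; rewrite eR eI; split; exact: sqkB.
  by rewrite eR eI !or ?oi // addr0 subr0.
(* [P] is not known to be linear, and the imaginary part of [zeta i] is 0. *)
have P0 : P 0 = 0.
  have h0 : sqk (0 : 'I_k -> G -> R) by move=> i; exact: sq0.
  have [s0 k0 _ o0] := hP 0 h0; apply: (ipk_eq0 s0).
  apply/eqP; rewrite -oppr_eq0; apply/eqP; rewrite -[RHS](o0 _ s0 k0).
  by rewrite (ipkBl h0 s0 s0) ipk0l sub0r.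
rewrite /vn_trace.
have zl2 i : l2pow (@zeta R G k i).
  by apply/l2powP; rewrite cRe_zeta cIm_zeta; split=> [|j];
    [exact: sqk_zetaR|exact: sq0].
have zi i : inner_pow (PC (@zeta R G k i)) (@zeta R G k i) =
    (P (zetaR _ i) i 1%g)%:C%C.
  have [sr _ _ _] := hP _ (sqk_zetaR _ _ i).
  rewrite inner_powE //; last first.
    apply/l2powP; rewrite ePr ePi cRe_zeta cIm_zeta P0; split=> // j; exact: sq0.
  by rewrite ePr ePi cRe_zeta cIm_zeta P0 !(ipkC _ 0) !ipk0l ipk_zetaR // addr0 subrr.
rewrite (eq_bigr _ (fun i _ => zi i)) -rmorph_sum; congr (_%:C)%C.
apply: (@cvg_unique _ _ _ _ _ _ _ hr) => //.
apply: cvgn_sum => i; have [sP _ tP _] := hP _ (sqk_zetaR _ _ i).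
exact: (@tends_pointwise _ _ _ (Q^~ (zetaR R i)) _ i 1%g (fun n => Qsq n (sqk_zetaR
  _ _ i)) sP tP).
Qed.

End KernelDimension.

(** * The machine on one block *)

Section BlockSystem.
Variables (V : zmodType) (n1 n2 n3 : nat).
Implicit Types y : nat -> nat -> nat -> V.

(* The kernel equations on a block of size (n1, n2, n3): y0 belongs to the
   diagonal walk, yL and yR to the two directions of the scan.  The last two
   equations kill the chains on which the scan completes. *)
Definition block_system y0 yL yR := forall i1 i2 i3,
  (i1 < n1)%N -> (i2 < n2)%N -> (i3 < n3)%N ->
  [/\ y0 i1 i2 i3 =
        (if (0 < i1)%N && (0 < i2)%N then y0 i1.-1 i2.-1 i3 else 0)
      + (if [&& i1 == 0%N, i2 == 0%N & (3 < i3)%N] then y0 i1 i2 i3 else 0),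
      yL i1 i2 i3 =
        (if (i1.+1 < n1)%N && (0 < i3)%N then yL i1.+1 i2 i3.-1 else 0)
      + (if [&& i1.+1 == n1, (i2.+1 < n2)%N & (0 < i3)%N]
         then yR i1 i2.+1 i3.-1 else 0)
      + (if [&& i1.+1 == n1, (0 < i1)%N, i2.+1 == n2 & (0 < i3)%N]
         then y0 i1 i2 i3.-1 else 0),
      yR i1 i2 i3 =
        (if (0 < i1)%N && (0 < i3)%N then yR i1.-1 i2 i3.-1 else 0)
      + (if [&& i1 == 0%N, (i2.+1 < n2)%N & (0 < i3)%N]
         then yL i1 i2.+1 i3.-1 else 0),
      (if (i1 == 0%N) && (i2 == 0%N) then yL i1 i2 i3 else 0) = 0 &
      (if (i1.+1 == n1) && (i2 == 0%N) then yR i1 i2 i3 else 0) = 0].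

(* The starting position on the third tape of the chain through a vertex;
   values below 4, in particular the junk value 0, mean that there is none. *)
Definition label0 (i1 i2 i3 : nat) := if i1 == i2 then i3 else 0%N.
Definition labelL (i1 i2 i3 : nat) :=
  if [&& n1 == n2, (1 < n1)%N & ~~ odd (n1.-1 - i2)]
  then (i3 - (1 + (n1.-1 - i2) * n1 + (n1.-1 - i1)))%N else 0%N.
Definition labelR (i1 i2 i3 : nat) :=
  if [&& n1 == n2, (1 < n1)%N & odd (n1.-1 - i2)]
  then (i3 - (1 + (n1.-1 - i2) * n1 + i1))%N else 0%N.

(** Visiting the points of a square takes [n1 ^ 2] steps, including the one that enters the corner,
    so a scan begun at [m] ends at position [m + n1 ^ 2] of tape 3. *)
Definition scan_completes (m : nat) :=
  [&& n1 == n2, (1 < n1)%N & (m + n1 ^ 2 < n3)%N].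

Section Labels.
Variable z : nat -> V.
Hypothesis z_lt4 : forall m, (m < 4)%N -> z m = 0.

Let z0 i1 i2 i3 := z (label0 i1 i2 i3).
Let zL i1 i2 i3 := z (labelL i1 i2 i3).
Let zR i1 i2 i3 := z (labelR i1 i2 i3).

Lemma label0_eq i1 i2 i3 : z0 i1 i2 i3 =
    (if (0 < i1)%N && (0 < i2)%N then z0 i1.-1 i2.-1 i3 else 0)
  + (if [&& i1 == 0%N, i2 == 0%N & (3 < i3)%N] then z0 i1 i2 i3 else 0).
Proof.
rewrite /z0 /label0; case: i1 i2 => [|i1] [|i2] //=; rewrite ?add0r ?addr0 //.
- by case: ltnP => // h; rewrite z_lt4.
- by rewrite z_lt4.
- by rewrite z_lt4.
Qed.

(** The number subtracted from [i3] in the labels counts the scan steps up to [(i1, i2)]: one to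
    enter the corner, [n1] for each finished row, and the offset in the current row. The parity of
    the row decides the direction. A predecessor has one step less and stands one position lower on
    tape 3, hence has the same label. *)
Lemma labelL_eq i1 i2 i3 : (i1 < n1)%N -> (i2 < n2)%N -> zL i1 i2 i3 =
    (if (i1.+1 < n1)%N && (0 < i3)%N then zL i1.+1 i2 i3.-1 else 0)
  + (if [&& i1.+1 == n1, (i2.+1 < n2)%N & (0 < i3)%N]
     then zR i1 i2.+1 i3.-1 else 0)
  + (if [&& i1.+1 == n1, (0 < i1)%N, i2.+1 == n2 & (0 < i3)%N]
     then z0 i1 i2 i3.-1 else 0).
Proof.
move=> h1 h2; rewrite /zL /zR /z0 /labelL /labelR /label0.
(* At position 0 the truncated subtraction gives label 0, where [z] vanishes. *)
case: i3 => [|i3]; first by rewrite !andbF !addr0 sub0n if_same z_lt4.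
rewrite !andbT /=; have [lt1|ge1] := ltnP i1.+1 n1.
  rewrite (_ : (i1.+1 == n1) = false) ?addr0 //=; last by lia.
  by case: ifP => // _; congr z; lia.
rewrite (_ : (i1.+1 == n1) = true) /= ?add0r; last by lia.
have [lt2|ge2] := ltnP i2.+1 n2.
  rewrite (_ : (i2.+1 == n2) = false) ?andbF ?addr0; last by lia.
  have [e|ne] := eqVneq n1 n2; last by rewrite z_lt4.
  have -> : (n1.-1 - i2 = (n1.-1 - i2.+1).+1)%N by lia.
  rewrite /= negbK mulSn; case: ifP => // _; congr z; lia.
rewrite (_ : (i2.+1 == n2) = true) ?andbT ?add0r; last by lia.
have [e|ne] := eqVneq n1 n2; last first.
  have -> : (i1 == i2) = false by lia.
  by rewrite /= z_lt4 // if_same.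
have -> : (n1.-1 - i2 = 0)%N by lia.
rewrite (_ : (i1 == i2) = true) /= ?andbT; last by lia.
rewrite (_ : (1 < n1)%N = (0 < i1)%N); last by lia.
case: ifP => _; last by rewrite z_lt4.
by congr z; lia.
Qed.

Lemma labelR_eq i1 i2 i3 : (i1 < n1)%N -> (i2 < n2)%N -> zR i1 i2 i3 =
    (if (0 < i1)%N && (0 < i3)%N then zR i1.-1 i2 i3.-1 else 0)
  + (if [&& i1 == 0%N, (i2.+1 < n2)%N & (0 < i3)%N]
     then zL i1 i2.+1 i3.-1 else 0).
Proof.
move=> h1 h2; rewrite /zL /zR /labelL /labelR.
case: i3 => [|i3]; first by rewrite !andbF !addr0 sub0n if_same z_lt4.
rewrite !andbT /=; case: i1 h1 => [|i1] h1 /=.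
  rewrite add0r; have [e|ne] := eqVneq n1 n2; last by rewrite /= z_lt4 // if_same.
  have [lt2|ge2] := ltnP i2.+1 n2.
    have -> : (n1.-1 - i2 = (n1.-1 - i2.+1).+1)%N by lia.
    by rewrite /= mulSn; case: ifP => // _; congr z; lia.
  have -> : (n1.-1 - i2 = 0)%N by lia.
  by rewrite andbF z_lt4.
by rewrite addr0; case: ifP => // _; congr z; lia.
Qed.

Hypothesis z_completed : forall m, scan_completes m -> z m = 0.

Lemma block_system_label : block_system z0 zL zR.
Proof.
move=> i1 i2 i3 h1 h2 h3; split; first exact: label0_eq.
- exact: labelL_eq.
- exact: labelR_eq.
- case: eqP => //= e1; case: eqP => //= e2; rewrite /zL /labelL e1 e2 !subn0.
  case: ifP => [/and3P[/eqP e n1gt _]|]; last by rewrite z_lt4.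
  (* A label of at least 4 shows that the subtraction is not truncated; then label plus [n1 ^ 2] is
     [i3], which is below [n3]. *)
  have [lt4|ge4] := ltnP (i3 - (1 + n1.-1 * n1 + n1.-1)) 4; first exact: z_lt4.
  apply: z_completed; rewrite /scan_completes e eqxx -e n1gt /=.
  have : (n1 ^ 2 = n1.-1 * n1 + n1.-1 + 1)%N by rewrite -mulnn; nia.
  lia.
- case: eqP => //= e1; case: eqP => //= e2; rewrite /zR /labelR e2 !subn0.
  case: ifP => [/and3P[/eqP e n1gt _]|]; last by rewrite z_lt4.
  have [lt4|ge4] := ltnP (i3 - (1 + n1.-1 * n1 + i1)) 4; first exact: z_lt4.
  apply: z_completed; rewrite /scan_completes e eqxx -e n1gt /=.
  have : (n1 ^ 2 = n1.-1 * n1 + n1.-1 + 1)%N by rewrite -mulnn; nia.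
  lia.
Qed.

End Labels.

Section Solve.
Variables y0 yL yR : nat -> nat -> nat -> V.
Hypothesis sys : block_system y0 yL yR.

Definition start_value m : V := if (3 < m)%N then y0 0%N 0%N m else 0.

Lemma start_value_lt4 m : (m < 4)%N -> start_value m = 0.
Proof. by rewrite /start_value => h; case: ltnP => //; lia. Qed.

Lemma solve0 i1 i2 i3 : (i1 < n1)%N -> (i2 < n2)%N -> (i3 < n3)%N ->
  y0 i1 i2 i3 = start_value (label0 i1 i2 i3).
Proof.
elim: i1 i2 => [|i1 IH] [|i2] h1 h2 h3;
  have [-> _ _ _ _] := sys h1 h2 h3; rewrite /= ?add0r ?addr0 //.
- by rewrite IH //; lia.
Qed.

(** Induction on [i3]: every scan step consumes a position of tape 3, so the scan cannot cycle, and
    at [i3 = 0] there is no predecessor and both values vanish. *)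
Lemma solveLR i1 i2 i3 : (i1 < n1)%N -> (i2 < n2)%N -> (i3 < n3)%N ->
  yL i1 i2 i3 = start_value (labelL i1 i2 i3) /\
  yR i1 i2 i3 = start_value (labelR i1 i2 i3).
Proof.
elim: i3 i1 i2 => [|i3 IH] i1 i2 h1 h2 h3; have [_ -> -> _ _] := sys h1 h2 h3.
  rewrite !andbF !addr0 /labelL /labelR !sub0n !if_same.
  by rewrite start_value_lt4.
have lt3 : (i3 < n3)%N by lia.
rewrite (labelL_eq start_value_lt4 i3.+1 h1 h2).
rewrite (labelR_eq start_value_lt4 i3.+1 h1 h2) /= !andbT; split.
  congr (_ + _ + _).
  - by case: ifP => // h; have [-> _] := IH i1.+1 i2 h h2 lt3.
  - by case: ifP => // /andP[_ h]; have [_ ->] := IH i1 i2.+1 h1 h lt3.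
  - by case: ifP => // _; rewrite solve0.
congr (_ + _).
- case: ifP => // h; have hp : (i1.-1 < n1)%N by lia.
  by have [_ ->] := IH i1.-1 i2 hp h2 lt3.
- by case: ifP => // /andP[_ h]; have [-> _] := IH i1 i2.+1 h1 h lt3.
Qed.

(** The scan of a square ends in row 0, at the right end if [n1.-1] is odd and at the left end
    otherwise; the halting equation there concerns a value equal to that at the start. *)
Lemma solve_completed_scan m : (3 < m)%N -> scan_completes m -> y0 0%N 0%N m = 0.
Proof.
move=> m4 /and3P[/eqP e n1gt lt3].
have e2 : (n1 ^ 2 = n1.-1 * n1 + n1.-1 + 1)%N by rewrite -mulnn; nia.
have -> : y0 0%N 0%N m = start_value m by rewrite /start_value m4.
have lt1 : (0 < n1)%N by lia. have lt1' : (n1.-1 < n1)%N by lia.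
have lt2 : (0 < n2)%N by lia.
have [o|o] := boolP (odd n1.-1).
  have [_ _ _ _] := sys lt1' lt2 lt3.
  have [_ ->] := solveLR lt1' lt2 lt3.
  rewrite prednK // eqxx /= /labelR subn0 o n1gt e eqxx -e /=.
  by have -> : (m + n1 ^ 2 - (1 + n1.-1 * n1 + n1.-1) = m)%N by lia.
have [_ _ _ + _] := sys lt1 lt2 lt3.
have [-> _] := solveLR lt1 lt2 lt3.
rewrite /= /labelL !subn0 o n1gt e eqxx -e /=.
by have -> : (m + n1 ^ 2 - (1 + n1.-1 * n1 + n1.-1) = m)%N by lia.
Qed.

End Solve.
End BlockSystem.

(** * The series *)

Section Value.
Variable R : realType.
Notation h := (2^-1 : R).

Let h0 : 0 < h. Proof. by rewrite invr_gt0. Qed.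
Let h1 : h < 1. Proof. by rewrite invf_lt1 // ltr1n. Qed.

Definition partial_series (n : nat) : R :=
  \sum_(1 <= k < n) (2 : R) ^- (k ^ 2 + 4 * k + 6)%N.

Lemma partial_seriesE n :
  partial_series n = \sum_(1 <= k < n) h ^+ (k ^ 2 + 4 * k + 6)%N.
Proof. by apply: eq_bigr => k _; rewrite exprVn. Qed.

Lemma geometric_tail k n : (k <= n)%N ->
  \sum_(k <= i < n) h ^+ i = 2 * h ^+ k - 2 * h ^+ n.
Proof.
elim: n => [|n IH]; first by rewrite leqn0 => /eqP ->; rewrite big_geq // subrr.
rewrite leq_eqVlt => /orP[/eqP ->|le]; first by rewrite big_geq // subrr.
by rewrite big_nat_recr //= IH // [h ^+ n.+1]exprS; lra.
Qed.

Lemma geometric_sum n : \sum_(0 <= i < n) h ^+ i = 2 - 2 * h ^+ n.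
Proof. by rewrite geometric_tail // expr0 mulr1. Qed.

Lemma geometric_from k n : (k <= n)%N ->
  \sum_(0 <= i < n) (if (k <= i)%N then h ^+ i else 0) = 2 * h ^+ k - 2 * h ^+ n.
Proof.
move=> le; rewrite (@big_cat_nat _ _ _ k) //= big_nat big1 ?add0r => [|i /andP[_ lt]].
  rewrite -geometric_tail // big_nat [RHS]big_nat.
  by apply: eq_bigr => i /andP[ki _]; rewrite ki.
by rewrite leqNgt lt.
Qed.

Lemma geometric_tail_le k n : \sum_(k <= i < n) h ^+ i <= 2 * h ^+ k.
Proof.
have [le|gt] := leqP k n; last first.
  by rewrite big_geq ?mulr_ge0 ?exprn_ge0 // ltnW.
by rewrite geometric_tail // gerBl mulr_ge0 // exprn_ge0 // ltW.
Qed.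

Lemma partial_series_tail K n : (0 < K)%N -> (K < n)%N ->
  h ^+ (K ^ 2 + 4 * K + 6) <= partial_series n - partial_series K
    <= 2 * h ^+ (K ^ 2 + 4 * K + 6).
Proof.
move=> K0 lt; rewrite !partial_seriesE (@big_cat_nat _ _ _ K) //=; last exact: ltnW.
rewrite [X in X - _]addrC addrK; apply/andP; split.
  rewrite big_ltn // lerDl sumr_ge0 // => i _; exact/exprn_ge0/ltW.
(* For [i >= K] the exponent [i ^ 2 + 4 * i + 6] is at least [(K ^ 2 + 3 * K + 6) + i], which leaves
   a geometric series. *)
apply: (@le_trans _ _ (\sum_(K <= i < n) h ^+ (K ^ 2 + 3 * K + 6) * h ^+ i)).
  rewrite big_nat [leRHS]big_nat; apply: ler_sum => i /andP[Ki _].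
  rewrite -exprD; apply: ler_wiXn2l; [exact: ltW|exact: ltW|nia].
rewrite -mulr_sumr; apply: le_trans (ler_wpM2l _ (geometric_tail_le K n)) _.
  exact/exprn_ge0/ltW.
rewrite mulrCA -exprD ler_pM2l //; apply: ler_wiXn2l; [exact: ltW|exact: ltW|lia].
Qed.

Lemma partial_series_cvg : cvg (partial_series n @[n --> \oo])%classic.
Proof.
apply: nondecreasing_is_cvgn.
  apply/nondecreasing_seqP => n; case: n => [|n].
    by rewrite /partial_series !big_geq.
  by rewrite /partial_series [leRHS]big_nat_recr //= lerDl -exprVn exprn_ge0 // ltW.
exists 2 => _ [n _ <-]; rewrite partial_seriesE.
apply: le_trans (_ : 2 * h ^+ 1 <= 2); last by rewrite expr1; lra.
apply: le_trans (geometric_tail_le 1 n).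
by apply: ler_sum => i _; apply: ler_wiXn2l; [exact: ltW|exact: ltW|lia].
Qed.

Lemma series_tail K : (0 < K)%N ->
  h ^+ (K ^ 2 + 4 * K + 6) <= limn partial_series - partial_series K
    <= 2 * h ^+ (K ^ 2 + 4 * K + 6).
Proof.
move=> K0; have c : (partial_series n - partial_series K @[n --> \oo] -->
    limn partial_series - partial_series K)%classic.
  by apply: cvgB; [exact: partial_series_cvg|exact: cvg_cst].
apply/andP; split.
  apply: (cvgr_to_ge c); exists K.+1 => // n /= lt.
  by have /andP[] := partial_series_tail K0 lt.
apply: (cvgr_to_le c); exists K.+1 => // n /= lt.
by have /andP[] := partial_series_tail K0 lt.
Qed.

Lemma partial_series_int K : (0 < K)%N ->
  2 ^+ (K.-1 ^ 2 + 4 * K.-1 + 6) * partial_series K \is a Num.int.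
Proof.
move=> K0; rewrite /partial_series mulr_sumr big_nat;
  apply: rpred_sum => k /andP[k1 kK].
have le : (k ^ 2 + 4 * k + 6 <= K.-1 ^ 2 + 4 * K.-1 + 6)%N.
  have : (k ^ 2 <= K.-1 ^ 2)%N by rewrite leq_exp2r //; lia.
  lia.
rewrite -(subnK le) exprD -mulrA divff ?mulr1; last by rewrite expf_neq0.
by apply: rpredX; exact: intr_nat.
Qed.

(** If the sum had denominator [y], then [y * 2 ^+ E] times the tail after the [y]-th term would be
    an integer, [E] being the exponent of that term. The next exponent exceeds [E] by [2 * y + 5],
    which forces this integer strictly between 0 and 1. *)
Lemma series_irrational : irrational (limn partial_series).
Proof.
move=> [s _ es]; set S := limn _ in es; set y := `|denq s|%N.
have yE : y%:R = (denq s)%:~R :> R.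
  by rewrite -[denq s]gez0_abs ?denq_ge0.
have y0 : (0 < y)%N by rewrite /y absz_gt0 denq_neq0.
have yS : y%:R * S \is a Num.int.
  rewrite -es yE /ratr mulrCA divff ?mulr1 ?intr_eq0 ?denq_neq0 //; exact: intr_int.
pose K := y.+1; have /andP[lo hi] := @series_tail K (ltn0Sn _).
set D := _ - _ in lo hi; pose E := (y ^ 2 + 4 * y + 6)%N.
have Zint : y%:R * 2 ^+ E * D \is a Num.int.
  rewrite /D mulrBr -/S; apply: rpredB.
    rewrite mulrAC; apply: rpredM => //; apply: rpredX; exact: intr_nat.
  rewrite -mulrA; apply: rpredM; first exact: intr_nat.
  exact: (@partial_series_int K).
have E2 : (0 : R) < 2 ^+ E by rewrite exprn_gt0.
have Zgt0 : 0 < y%:R * 2 ^+ E * D.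
  rewrite mulr_gt0 ?mulr_gt0 ?ltr0n //; apply: lt_le_trans lo; exact: exprn_gt0.
have Zlt1 : y%:R * 2 ^+ E * D < 1.
  apply: (@le_lt_trans _ _ (y%:R * h ^+ y)).
    rewrite -mulrA ler_pM2l ?ltr0n //.
    apply: (@le_trans _ _ (2 ^+ E * (2 * h ^+ (K ^ 2 + 4 * K + 6)))).
      by rewrite ler_pM2l.
    have -> : (K ^ 2 + 4 * K + 6 = E + 1 + (y + 4) + y)%N.
      by rewrite /K /E -!mulnn; lia.
    have hE : 2 ^+ E * h ^+ E = 1 by rewrite -exprMn divff // expr1n.
    rewrite (exprD h _ y) (exprD h _ (y + 4)) (exprD h E 1) expr1.
    have -> : 2 ^+ E * (2 * (h ^+ E * h * h ^+ (y + 4) * h ^+ y)) =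
        (2 ^+ E * h ^+ E) * (h ^+ (y + 4) * h ^+ y).
      by move: (2 ^+ E) (h ^+ E) (h ^+ (y + 4)) (h ^+ y) => *; field.
    by rewrite hE mul1r ler_piMl ?exprn_ge0 ?exprn_ile1 // ltW.
  by rewrite exprVn ltr_pdivrMr ?exprn_gt0 // mul1r -natrX ltr_nat ltn_expl.
have := Zint; rewrite intrEge0 ?ltW // => /natrP[k ek].
by move: Zgt0 Zlt1; rewrite ek ltr0n ltrn1 => k0 k1; lia.
Qed.

Lemma value_irrational : irrational (64^-1 - 8^-1 * limn partial_series).
Proof.
move=> [s _ es]; apply: series_irrational; exists (8 * (64^-1 - s)) => //.
by rewrite rmorphM rmorphB /= es fmorphV !ratr_nat; field.
Qed.

Lemma geometric_cvg0 : (h ^+ n @[n --> \oo] --> 0)%classic.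
Proof. by apply: cvg_expr; rewrite ger0_norm // ltW. Qed.

(** The range of [d] goes up to [N ^ 2] so that it reaches the threshold [a.+1 ^ 2] for every
    [a < N]. *)
Definition chain_weight N : R :=
  \sum_(0 <= a < N) \sum_(0 <= b < N) \sum_(0 <= m < N) \sum_(0 <= d < N ^ 2)
    (if ~~ [&& a == b, (0 < a)%N & (a.+1 ^ 2 <= d)%N]
     then h ^+ (a + b + m + d + 10) else 0).

(** All chains minus the excluded ones. For the latter the sum over [d] is
    [2 * h ^+ (a.+1 ^ 2) - 2 * h ^+ (N ^ 2)]: its first part gives the series, because [10 + 2 * a +
    a.+1 ^ 2 - 2 = a ^ 2 + 4 * a + 9], and its second part the error term in the last line. *)
Lemma chain_weightE N : chain_weight N =
  h ^+ 10 * (2 - 2 * h ^+ N) ^+ 3 * (2 - 2 * h ^+ (N ^ 2))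
  - (1 - h ^+ N) * 8^-1 * partial_series N
  + (2 - 2 * h ^+ N) * h ^+ 9 * (h ^+ (N ^ 2) * \sum_(1 <= a < N) h ^+ (2 * a)).
Proof.
pose g n := \sum_(0 <= i < n) h ^+ i.
have split1 a b m d : (if ~~ [&& a == b, (0 < a)%N & (a.+1 ^ 2 <= d)%N]
     then h ^+ (a + b + m + d + 10) else 0) =
    h ^+ 10 * h ^+ a * h ^+ b * h ^+ m * h ^+ d
    - (if b == a then if (0 < a)%N then h ^+ 10 * h ^+ a * h ^+ b * h ^+ m *
        (if (a.+1 ^ 2 <= d)%N then h ^+ d else 0) else 0 else 0).
  rewrite [b == a]eq_sym !exprD; case: (a == b); case: (0 < a)%N;
    case: (a.+1 ^ 2 <= d)%N => /=; rewrite ?mulr0 ?subr0; ring.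
have main : \sum_(0 <= a < N) \sum_(0 <= b < N) \sum_(0 <= m < N)
    \sum_(0 <= d < N ^ 2) h ^+ 10 * h ^+ a * h ^+ b * h ^+ m * h ^+ d =
    h ^+ 10 * g N ^+ 3 * g (N ^ 2)%N.
  under eq_bigr do under eq_bigr do under eq_bigr do rewrite -mulr_sumr -/(g _).
  under eq_bigr do under eq_bigr do rewrite -mulr_suml -mulr_sumr -/(g _).
  under eq_bigr do rewrite -!mulr_suml -mulr_sumr -/(g _).
  have -> : g N ^+ 3 = g N * g N * g N by rewrite -expr2 -exprSr.
  by rewrite -!mulr_suml -mulr_sumr -/(g _) !mulrA.
have badE : \sum_(0 <= a < N) \sum_(0 <= b < N) \sum_(0 <= m < N)
    \sum_(0 <= d < N ^ 2) (if b == a then if (0 < a)%N then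
      h ^+ 10 * h ^+ a * h ^+ b * h ^+ m *
        (if (a.+1 ^ 2 <= d)%N then h ^+ d else 0) else 0 else 0) =
    \sum_(1 <= a < N) h ^+ 10 * h ^+ (2 * a) * g N *
      (2 * h ^+ (a.+1 ^ 2) - 2 * h ^+ (N ^ 2)).
  have inner a : (a < N)%N -> \sum_(0 <= b < N) \sum_(0 <= m < N)
    \sum_(0 <= d < N ^ 2) (if b == a then if (0 < a)%N then
      h ^+ 10 * h ^+ a * h ^+ b * h ^+ m *
        (if (a.+1 ^ 2 <= d)%N then h ^+ d else 0) else 0 else 0) =
    if (0 < a)%N then h ^+ 10 * h ^+ (2 * a) * g N *
      (2 * h ^+ (a.+1 ^ 2) - 2 * h ^+ (N ^ 2)) else 0.
    move=> aN; transitivity (\sum_(0 <= b < N | b == a) \sum_(0 <= m < N)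
      \sum_(0 <= d < N ^ 2) (if (0 < a)%N then
      h ^+ 10 * h ^+ a * h ^+ b * h ^+ m *
        (if (a.+1 ^ 2 <= d)%N then h ^+ d else 0) else 0)).
      rewrite [RHS]big_mkcond; apply: eq_bigr => b _; case: eqP => // _.
      by rewrite big1 // => m _; rewrite big1.
    rewrite big_nat1_eq aN /=; case: (posnP a) => a0.
      by rewrite big1 // => m _; rewrite big1.
    under eq_bigr do rewrite -mulr_sumr geometric_from ?leq_exp2r //.
    rewrite -mulr_suml -mulr_sumr -/(g N); congr (_ * _ * _).
    by rewrite -mulrA -exprD addnn mul2n.
  rewrite big_nat; under eq_bigr => a /andP[_ aN] do rewrite inner //.
  rewrite -big_nat; case: N {inner split1 main} => [|N']; first by rewrite !big_geq.
  rewrite big_ltn //= add0r big_nat [RHS]big_nat.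
  by apply: eq_bigr => a /andP[a0 _]; rewrite a0.
rewrite /chain_weight.
under eq_bigr do under eq_bigr do under eq_bigr do under eq_bigr do rewrite split1.
under eq_bigr do under eq_bigr do under eq_bigr do rewrite sumrB.
under eq_bigr do under eq_bigr do rewrite sumrB.
under eq_bigr do rewrite sumrB.
rewrite sumrB main badE /g !geometric_sum partial_seriesE.
have -> : \sum_(1 <= a < N) h ^+ 10 * h ^+ (2 * a) * (2 - 2 * h ^+ N) *
      (2 * h ^+ (a.+1 ^ 2) - 2 * h ^+ (N ^ 2)) =
   \sum_(1 <= a < N) ((1 - h ^+ N) * 8^-1 * h ^+ (a ^ 2 + 4 * a + 6)
    - (2 - 2 * h ^+ N) * h ^+ 9 * (h ^+ (N ^ 2) * h ^+ (2 * a))).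
  apply: eq_bigr => a _.
  have -> : (a.+1 ^ 2 = a ^ 2 + 2 * a + 1)%N by rewrite -!mulnn; lia.
  have -> : (a ^ 2 + 4 * a + 6 = a ^ 2 + 2 * a + 2 * a + 6)%N by lia.
  by rewrite !exprD; field.
by rewrite sumrB -!mulr_sumr opprB addrA addrAC -addrA (addrC (- _)) addrA.
Qed.

Lemma chain_weight_cvg :
  (chain_weight N @[N --> \oo] --> 64^-1 - 8^-1 * limn partial_series)%classic.
Proof.
have cN2 : (h ^+ (N ^ 2) @[N --> \oo] --> 0)%classic.
  apply: (@squeeze_cvgr _ _ _ _ (fun=> 0) (fun N => h ^+ N)).
  - near=> N; apply/andP; split; first exact/exprn_ge0/ltW.
    by apply: ler_wiXn2l; [exact: ltW|exact: ltW|nia].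
  - exact: cvg_cst.
  - exact: geometric_cvg0.
have cE : (h ^+ (N ^ 2) * \sum_(1 <= a < N) h ^+ (2 * a) @[N --> \oo] --> 0)%classic.
  apply: (@squeeze_cvgr _ _ _ _ (fun=> 0) (fun N => h ^+ (N ^ 2))).
  - near=> N; have hN : 0 <= h ^+ (N ^ 2) by exact/exprn_ge0/ltW.
    apply/andP; split.
      by rewrite mulr_ge0 // sumr_ge0 // => i _; exact/exprn_ge0/ltW.
    rewrite ler_piMr //.
    apply: le_trans (_ : 2 * h ^+ 1 <= 1); last by rewrite expr1; lra.
    apply: le_trans (geometric_tail_le 1 N).
    by apply: ler_sum => i _; apply: ler_wiXn2l; [exact: ltW|exact: ltW|lia].
  - exact: cvg_cst.
  - exact: cN2.
under eq_fun do rewrite chain_weightE.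
have -> : 64^-1 - 8^-1 * limn partial_series =
  h ^+ 10 * (2 - 2 * 0) ^+ 3 * (2 - 2 * 0) -
  (1 - 0) * 8^-1 * limn partial_series + (2 - 2 * 0) * h ^+ 9 * 0.
  by move: (limn _) => x; field.
have c2 : ((2 - 2 * h ^+ N) @[N --> \oo] --> (2 - 2 * 0 : R))%classic.
  apply: cvgB; first exact: cvg_cst.
  by apply: cvgM; [exact: cvg_cst|exact: geometric_cvg0].
have c2' : ((2 - 2 * h ^+ (N ^ 2)) @[N --> \oo] --> (2 - 2 * 0 : R))%classic.
  apply: cvgB; first exact: cvg_cst.
  by apply: cvgM; [exact: cvg_cst|exact: cN2].
apply: cvgD; first apply: cvgB.
- apply: cvgM => //; apply: cvgM; first exact: cvg_cst.
  rewrite !exprS expr0; under eq_fun do rewrite !exprS expr0.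
  by do 3!(apply: cvgM => //); exact: cvg_cst.
- apply: cvgM; last exact: partial_series_cvg.
  apply: cvgM; last exact: cvg_cst.
  by apply: cvgB; [exact: cvg_cst|exact: geometric_cvg0].
- apply: cvgM => //; apply: cvgM => //; exact: cvg_cst.
Unshelve. all: by end_near. Qed.

End Value.

(** * Three tapes *)

Section Runs.
Variables (R : realType) (G : groupType).

Lemma geometric_le0 (c C : R) : (forall N, c <= C * 2^-1 ^+ N) -> c <= 0.
Proof.
move=> h; rewrite leNgt; apply/negP => c0.
have C0 : 0 < C by have := h 0; rewrite expr0 mulr1; exact: lt_le_trans.
have := archi_boundP (ltW (divr_gt0 C0 c0)); set N := Num.bound _ => hN.
have : (N%:R : R) < 2 ^+ N by rewrite -natrX ltr_nat ltn_expl.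
have p2 : (0 : R) < 2 ^+ N by rewrite exprn_gt0.
have := h N; rewrite exprVn ler_pdivlMr // => h1 h2.
move: hN; rewrite ltr_pdivrMr // => h3.
have : c * 2 ^+ N <= C by [].
nra.
Qed.

(* [rconv b f] is fixed by all the projections [d N], whose traces tend to 0. *)
Lemma annihilated_of_runs (d : nat -> group_ring G) (b : group_ring G) (f : G -> R) :
  sq f -> d 0%N = 1 -> (forall N, gr_star (d N) = d N) ->
  (forall N, d N * d N = d N) -> (forall N, (d N)@_1%g = 2^-1 ^+ N) ->
  (forall i, rconv ((d i - d i.+1) * b) f = 0) -> rconv b f = 0.
Proof.
move=> hf d0 sd dd td h; have hb := sq_rconv b hf.
have eN N : rconv (d N) (rconv b f) = rconv b f.
  elim: N => [|N IH]; first by rewrite d0 rconv1.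
  have := h N; rewrite rconvM rconvBl => /eqP; rewrite subr_eq0 => /eqP <-.
  exact: IH.
apply/funext => x; apply/eqP; rewrite -[_ == _]sqrf_eq0 eq_le sqr_ge0 andbT.
apply: (@geometric_le0 _ (ip (rconv b f) (rconv b f))) => N.
have := @proj_pointwise_le R _ (d N) (rconv b f) x hb (sd N) (dd N).
by rewrite eN td rmorphXn fmorphV rmorph_nat.
Qed.

End Runs.

Opaque gr_mul gr_one gr_star mon rconv fgadd fgopp fgzero.

(** * The machine on three tapes, from the relations between matrix units alone *)

Section ThreeTapes.
Variables (A : nzRingType) (star : A -> A) (tr : A -> rat).
Hypothesis star1A : star 1 = 1.
Hypothesis starMA : forall a b, star (a * b) = star b * star a.
Hypothesis tr1 : tr 1 = 1.

(* [stepr] moves the head one step to the right inside a block, [block_unit n i]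
   carries the left end of a block of size [n] to its [i]-th position. *)
Variables (stepr stepl left_end right_end past4 : A) (block_unit : nat -> nat -> A)
  (block_proj : nat -> A).
Hypothesis star_stepr : star stepr = stepl.
Hypothesis star_stepl : star stepl = stepr.
Hypothesis star_left_end : star left_end = left_end.
Hypothesis star_right_end : star right_end = right_end.
Hypothesis star_past4 : star past4 = past4.
Hypothesis stepr_unit : forall n i, (i < n)%N ->
  stepr * block_unit n i = if (i.+1 < n)%N then block_unit n i.+1 else 0.
Hypothesis stepl_unit : forall n i, (i < n)%N ->
  stepl * block_unit n i = if (0 < i)%N then block_unit n i.-1 else 0.
Hypothesis stepr_stepl_unit : forall n i, (i < n)%N ->
  stepr * stepl * block_unit n i = if (0 < i)%N then block_unit n i else 0.
Hypothesis left_end_unit : forall n i, (i < n)%N ->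
  left_end * block_unit n i = if i == 0%N then block_unit n i else 0.
Hypothesis right_end_unit : forall n i, (i < n)%N ->
  right_end * block_unit n i = if i.+1 == n then block_unit n i else 0.
Hypothesis past4_unit : forall n i, (i < n)%N ->
  past4 * block_unit n i = if (3 < i)%N then block_unit n i else 0.
Hypothesis star_unit_unit : forall n n' i i', (i < n)%N -> (i' < n')%N ->
  star (block_unit n i) * block_unit n' i' =
    if (n == n') && (i == i') then block_proj n else 0.
Hypothesis star_block_proj : forall n, star (block_proj n) = block_proj n.
Hypothesis block_unit_proj : forall n i, block_unit n i * block_proj n =
  block_unit n i.
Hypothesis block_proj_trace : forall n, (0 < n)%N -> tr (block_proj n) = 2^-1 ^+ n.+1.

(* The projections onto the configurations with [N] zeros to the right,
   resp. to the left, of the head. *)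
Variables right_run left_run : nat -> A.
Hypothesis right_run0 : right_run 0%N = 1.
Hypothesis left_run0 : left_run 0%N = 1.
Hypothesis star_right_run : forall N, star (right_run N) = right_run N.
Hypothesis star_left_run : forall N, star (left_run N) = left_run N.
Hypothesis right_run_idem : forall N, right_run N * right_run N = right_run N.
Hypothesis left_run_idem : forall N, left_run N * left_run N = left_run N.
Hypothesis right_run_trace : forall N, tr (right_run N) = 2^-1 ^+ N.
Hypothesis left_run_trace : forall N, tr (left_run N) = 2^-1 ^+ N.
Hypothesis unit_star_unit : forall i j,
  block_unit (i + j).+1 i * star (block_unit (i + j).+1 i) =
  (right_run i - right_run i.+1) * (left_run j - left_run j.+1).

Variables (R : realType) (H : groupType).
Variable ten3 : A -> A -> A -> group_ring H.
Notation fnR := (H -> R).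
Hypothesis ten3M : forall a b c a' b' c',
  ten3 a b c * ten3 a' b' c' = ten3 (a * a') (b * b') (c * c').
Hypothesis star_ten3 : forall a b c,
  gr_star (ten3 a b c) = ten3 (star a) (star b) (star c).
Hypothesis ten3Bl : forall a a' b c, ten3 (a - a') b c = ten3 a b c - ten3 a' b c.
Hypothesis ten3Bm : forall a b b' c, ten3 a (b - b') c = ten3 a b c - ten3 a b' c.
Hypothesis ten3Br : forall a b c c', ten3 a b (c - c') = ten3 a b c - ten3 a b c'.
Hypothesis ten3_111 : ten3 1 1 1 = 1.
Hypothesis trace_ten3 : forall a b c, (ten3 a b c)@_1%g = tr a * tr b * tr c.

Lemma ten3_0l b c : ten3 0 b c = 0. Proof. by rewrite -(subrr 0) ten3Bl subrr. Qed.
Lemma ten3_0m a c : ten3 a 0 c = 0. Proof. by rewrite -(subrr 0) ten3Bm subrr. Qed.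
Lemma ten3_0r a b : ten3 a b 0 = 0. Proof. by rewrite -(subrr 0) ten3Br subrr. Qed.

Definition box_unit (n i : nat * nat * nat) : group_ring H :=
  ten3 (block_unit n.1.1 i.1.1) (block_unit n.1.2 i.1.2) (block_unit n.2 i.2).
Definition inbox (n i : nat * nat * nat) :=
  [&& (i.1.1 < n.1.1)%N, (i.1.2 < n.1.2)%N & (i.2 < n.2)%N].

(** By [unit_star_unit], [f] is killed by all products of differences of run projections, with six
    factors, two per tape. Each family of differences telescopes to 1 up to a projection of trace
    [2^-1 ^+ N], so the factors can be removed one at a time. *)
Lemma box_unit_complete (f : fnR) : sq f ->
  (forall n i, inbox n i -> rconv (gr_star (box_unit n i)) f = 0) -> f = 0.
Proof.
move=> hf h; pose D (d : nat -> A) i : A := d i - d i.+1.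
have h6 i1 j1 i2 j2 i3 j3 : rconv (ten3 (D right_run i1 * D left_run j1)
    (D right_run i2 * D left_run j2) (D right_run i3 * D left_run j3)) f = 0.
  rewrite /D -!unit_star_unit.
  have := h ((i1 + j1).+1, (i2 + j2).+1, (i3 + j3).+1) (i1, i2, i3).
  rewrite /inbox /= !ltnS !leq_addr => /(_ isT) e.
  by rewrite -ten3M -star_ten3 rconvM e rconv0r.
have s1 (d : nat -> A) b : (forall N, star (d N) = d N) -> d 0%N = 1 ->
    (forall N, d N * d N = d N) -> (forall N, tr (d N) = 2^-1 ^+ N) ->
    forall x y, (forall i, rconv (ten3 (D d i * b) x y) f = 0) ->
    rconv (ten3 b x y) f = 0.
  move=> sd d0 dd td x y hi.
  apply: (@annihilated_of_runs _ _ (fun N => ten3 (d N) 1 1)) => //.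
  - by rewrite d0 ten3_111.
  - by move=> N; rewrite star_ten3 sd star1A.
  - by move=> N; rewrite ten3M dd !mulr1.
  - by move=> N; rewrite trace_ten3 td tr1 !mulr1.
  - by move=> i; rewrite -ten3Bl ten3M !mul1r; exact: hi.
have s2 (d : nat -> A) b : (forall N, star (d N) = d N) -> d 0%N = 1 ->
    (forall N, d N * d N = d N) -> (forall N, tr (d N) = 2^-1 ^+ N) ->
    forall x y, (forall i, rconv (ten3 x (D d i * b) y) f = 0) ->
    rconv (ten3 x b y) f = 0.
  move=> sd d0 dd td x y hi.
  apply: (@annihilated_of_runs _ _ (fun N => ten3 1 (d N) 1)) => //.
  - by rewrite d0 ten3_111.
  - by move=> N; rewrite star_ten3 sd star1A.
  - by move=> N; rewrite ten3M dd !mulr1.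
  - by move=> N; rewrite trace_ten3 td tr1 mul1r mulr1.
  - by move=> i; rewrite -ten3Bm ten3M !mul1r; exact: hi.
have s3 (d : nat -> A) b : (forall N, star (d N) = d N) -> d 0%N = 1 ->
    (forall N, d N * d N = d N) -> (forall N, tr (d N) = 2^-1 ^+ N) ->
    forall x y, (forall i, rconv (ten3 x y (D d i * b)) f = 0) ->
    rconv (ten3 x y b) f = 0.
  move=> sd d0 dd td x y hi.
  apply: (@annihilated_of_runs _ _ (fun N => ten3 1 1 (d N))) => //.
  - by rewrite d0 ten3_111.
  - by move=> N; rewrite star_ten3 sd star1A.
  - by move=> N; rewrite ten3M dd !mulr1.
  - by move=> N; rewrite trace_ten3 td tr1 !mul1r.
  - by move=> i; rewrite -ten3Br ten3M !mul1r; exact: hi.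
rewrite -[f]rconv1 -ten3_111.
apply: (s1 _ _ star_left_run left_run0 left_run_idem left_run_trace) => j1.
rewrite mulr1 -[D _ _]mul1r.
apply: (s2 _ _ star_left_run left_run0 left_run_idem left_run_trace) => j2.
apply: (s3 _ _ star_left_run left_run0 left_run_idem left_run_trace) => j3.
rewrite !mulr1 mul1r.
apply: (s1 _ _ star_right_run right_run0 right_run_idem right_run_trace) => i1.
apply: (s2 _ _ star_right_run right_run0 right_run_idem right_run_trace) => i2.
apply: (s3 _ _ star_right_run right_run0 right_run_idem right_run_trace) => i3.
exact: h6.
Qed.

Definition s0 : 'I_3 := ord0.
Definition sL : 'I_3 := lift ord0 ord0.
Definition sR : 'I_3 := ord_max.

(** Row [s] is the identity minus the steps that lead into state [s]. At a start the term with
    [past4] gives the value back, so nothing is imposed; any other configuration without predecessor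
    gets 0. The factor [stepr * stepl] demands [0 < i1] in the corner, which rules out [n = 1] and
    makes the series begin at [k = 1]. *)
Definition transition_op : 'M[group_ring H]_3 := \matrix_(i, j)
  match val i, val j with
  | 0%N, 0%N => 1 - ten3 stepr stepr 1 - ten3 left_end left_end past4
  | 1%N, 0%N => - ten3 (right_end * (stepr * stepl)) right_end stepr
  | 1%N, 1%N => 1 - ten3 stepl 1 stepr
  | 1%N, 2%N => - ten3 right_end stepl stepr
  | 2%N, 1%N => - ten3 left_end stepl stepr
  | 2%N, 2%N => 1 - ten3 stepr 1 stepr
  | _, _ => 0
  end.

Definition halting_op : 'M[group_ring H]_3 := \matrix_(i, j)
  match val i, val j with
  | 1%N, 1%N => ten3 left_end left_end 1
  | 2%N, 2%N => ten3 right_end left_end 1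
  | _, _ => 0
  end.

Definition machine_op := adjmx transition_op *m transition_op + adjmx halting_op *m
  halting_op.

Definition component (v : 'I_3 -> H -> R) n s i1 i2 i3 : H -> R :=
  rconv (gr_star (box_unit n (i1, i2, i3))) (v s).

Lemma ord3P (s : 'I_3) : [\/ s = s0, s = sL | s = sR].
Proof.
by case: s => [[|[|[|m]]] lt] //; [apply: Or31|apply: Or32|apply: Or33];
  exact: val_inj.
Qed.

Lemma big3 (F : 'I_3 -> H -> R) : \sum_j F j = F s0 + F sL + F sR.
Proof.
rewrite !big_ord_recl big_ord0 addr0 addrA; congr (_ + F _ + F _); exact: val_inj.
Qed.

(** A component is taken with the adjoint of a matrix unit, so an operator reaches the unit through
    its own adjoint: a step forward in the matrix becomes the index of the predecessor. *)
Lemma component_act n i a b c (f : fnR) :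
  rconv (gr_star (box_unit n i)) (rconv (ten3 a b c) f) =
  rconv (gr_star (ten3 (star a * block_unit n.1.1 i.1.1) (star b * block_unit n.1.2
    i.1.2)
                       (star c * block_unit n.2 i.2))) f.
Proof. have -> : ten3 (star a * block_unit n.1.1 i.1.1) (star b * block_unit n.1.2
  i.1.2)
  (star c * block_unit n.2 i.2) = gr_star (ten3 a b c) * box_unit n i.
  by rewrite star_ten3 ten3M.
by rewrite starM starK rconvM. Qed.

Section Action.
Variables (v : 'I_3 -> H -> R) (n1 n2 n3 i1 i2 i3 : nat).
Hypotheses (h1 : (i1 < n1)%N) (h2 : (i2 < n2)%N) (h3 : (i3 < n3)%N).
Let n := (n1, n2, n3).
Let i := (i1, i2, i3).
Notation y := (component v n).

Let rconv_if (b1 b2 b3 : bool) x1 x2 x3 (f : fnR) :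
  rconv (gr_star (ten3 (if b1 then x1 else 0) (if b2 then x2 else 0)
                       (if b3 then x3 else 0))) f =
  if [&& b1, b2 & b3] then rconv (gr_star (ten3 x1 x2 x3)) f else 0.
Proof.
case: b1; last by rewrite ten3_0l raddf0 rconv0l.
case: b2; last by rewrite ten3_0m raddf0 rconv0l.
by case: b3; last by rewrite ten3_0r raddf0 rconv0l.
Qed.

Lemma component_transition0 : rconv (gr_star (box_unit n i)) (mxactR transition_op v
  s0) =
  y s0 i1 i2 i3 -
  ((if (0 < i1)%N && (0 < i2)%N then y s0 i1.-1 i2.-1 i3 else 0)
   + (if [&& i1 == 0%N, i2 == 0%N & (3 < i3)%N] then y s0 i1 i2 i3 else 0)).
Proof.
have -> : mxactR transition_op v s0 = v s0 - rconv (ten3 stepr stepr 1) (v s0)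
    - rconv (ten3 left_end left_end past4) (v s0).
  rewrite /mxactR big3 !mxE /=.
  by rewrite !rconv0l !addr0 !rconvBl rconv1.
rewrite 2!rconvBr 2!component_act /=.
rewrite star_stepr star1A star_left_end star_past4 mul1r.
rewrite (stepl_unit h1) (stepl_unit h2) (left_end_unit h1) (left_end_unit h2)
  (past4_unit h3).
have := rconv_if (0 < i1)%N (0 < i2)%N true.
move=> /(_ (block_unit n1 i1.-1) (block_unit n2 i2.-1) (block_unit n3 i3) (v s0));
  rewrite andbT => ->.
by rewrite rconv_if opprD addrA.
Qed.

Lemma component_transitionL : rconv (gr_star (box_unit n i)) (mxactR transition_op v
  sL) =
  y sL i1 i2 i3 -
  ((if (i1.+1 < n1)%N && (0 < i3)%N then y sL i1.+1 i2 i3.-1 else 0)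
   + (if [&& i1.+1 == n1, (i2.+1 < n2)%N & (0 < i3)%N]
      then y sR i1 i2.+1 i3.-1 else 0)
   + (if [&& i1.+1 == n1, (0 < i1)%N, i2.+1 == n2 & (0 < i3)%N]
      then y s0 i1 i2 i3.-1 else 0)).
Proof.
have -> : mxactR transition_op v sL = v sL - rconv (ten3 stepl 1 stepr) (v sL)
    - rconv (ten3 right_end stepl stepr) (v sR)
    - rconv (ten3 (right_end * (stepr * stepl)) right_end stepr) (v s0).
  rewrite /mxactR big3 !mxE /= !rconvNl rconvBl rconv1.
  by rewrite -addrA addrC.
rewrite 3!rconvBr 3!component_act /=.
rewrite star_stepr star_stepl star1A star_right_end !starMA star_stepr star_stepl
  star_right_end mul1r.
rewrite (stepr_unit h1) (stepr_unit h2) (stepl_unit h3) (right_end_unit h1)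
  (right_end_unit h2).
have -> : stepr * stepl * right_end * block_unit n1 i1 =
    if (i1.+1 == n1) && (0 < i1)%N then block_unit n1 i1 else 0.
  rewrite -mulrA (right_end_unit h1); case: eqP => _; last by rewrite mulr0.
  exact: stepr_stepl_unit.
have := rconv_if (i1.+1 < n1)%N true (0 < i3)%N.
move=> /(_ (block_unit n1 i1.+1) (block_unit n2 i2) (block_unit n3 i3.-1) (v sL)) /=
  ->.
by rewrite !rconv_if !opprD !addrA -andbA.
Qed.

Lemma component_transitionR : rconv (gr_star (box_unit n i)) (mxactR transition_op v
  sR) =
  y sR i1 i2 i3 -
  ((if (0 < i1)%N && (0 < i3)%N then y sR i1.-1 i2 i3.-1 else 0)
   + (if [&& i1 == 0%N, (i2.+1 < n2)%N & (0 < i3)%N]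
      then y sL i1 i2.+1 i3.-1 else 0)).
Proof.
have -> : mxactR transition_op v sR = v sR - rconv (ten3 stepr 1 stepr) (v sR)
    - rconv (ten3 left_end stepl stepr) (v sL).
  rewrite /mxactR big3 !mxE /= !rconvNl rconvBl rconv1 rconv0l add0r.
  by rewrite addrC.
rewrite 2!rconvBr 2!component_act /=.
rewrite star_stepr star_stepl star1A star_left_end mul1r.
rewrite (stepl_unit h1) (stepr_unit h2) (stepl_unit h3) (left_end_unit h1).
have := rconv_if (0 < i1)%N true (0 < i3)%N.
move=> /(_ (block_unit n1 i1.-1) (block_unit n2 i2) (block_unit n3 i3.-1) (v sR)) /=
  ->.
by rewrite !rconv_if !opprD !addrA.
Qed.

Lemma halting0 : mxactR halting_op v s0 = 0.
Proof. by rewrite /mxactR big3 !mxE /= !rconv0l !addr0. Qed.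

Lemma component_haltingL : rconv (gr_star (box_unit n i)) (mxactR halting_op v sL) =
  if (i1 == 0%N) && (i2 == 0%N) then y sL i1 i2 i3 else 0.
Proof.
have -> : mxactR halting_op v sL = rconv (ten3 left_end left_end 1) (v sL).
  by rewrite /mxactR big3 !mxE /= !rconv0l addr0 add0r.
rewrite component_act /= star1A star_left_end mul1r.
rewrite (left_end_unit h1) (left_end_unit h2).
have := rconv_if (i1 == 0%N) (i2 == 0%N) true.
by move=> /(_ (block_unit n1 i1) (block_unit n2 i2) (block_unit n3 i3) (v sL));
  rewrite andbT => ->.
Qed.

Lemma component_haltingR : rconv (gr_star (box_unit n i)) (mxactR halting_op v sR) =
  if (i1.+1 == n1) && (i2 == 0%N) then y sR i1 i2 i3 else 0.
Proof.
have -> : mxactR halting_op v sR = rconv (ten3 right_end left_end 1) (v sR).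
  by rewrite /mxactR big3 !mxE /= !rconv0l !add0r.
rewrite component_act /= star1A star_right_end star_left_end mul1r.
rewrite (right_end_unit h1) (left_end_unit h2).
have := rconv_if (i1.+1 == n1) (i2 == 0%N) true.
by move=> /(_ (block_unit n1 i1) (block_unit n2 i2) (block_unit n3 i3) (v sR));
  rewrite andbT => ->.
Qed.

End Action.

(** A vector vanishes once all its components do, by [box_unit_complete]; so the operator equation
    amounts to one finite system for each size of box. *)
Lemma ker_machine_op (v : 'I_3 -> H -> R) : sqk v ->
  mxactR machine_op v = 0 <-> forall n1 n2 n3,
    block_system n1 n2 n3 (component v (n1, n2, n3) s0)
      (component v (n1, n2, n3) sL) (component v (n1, n2, n3) sR).
Proof.
move=> hv; rewrite /machine_op (ker_adjmxM_add transition_op halting_op hv); split.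
  move=> [e1 e2] n1 n2 n3 i1 i2 i3 h1 h2 h3; split.
  - by apply/eqP; rewrite -subr_eq0 -(component_transition0 v h1 h2 h3) e1 rconv0r.
  - by apply/eqP; rewrite -subr_eq0 -(component_transitionL v h1 h2 h3) e1 rconv0r.
  - by apply/eqP; rewrite -subr_eq0 -(component_transitionR v h1 h2 h3) e1 rconv0r.
  - by rewrite -(component_haltingL v n3 i3 h1 h2) e2 rconv0r.
  - by rewrite -(component_haltingR v n3 i3 h1 h2) e2 rconv0r.
move=> sys.
split; apply/funext => s.
  apply: (box_unit_complete (sqk_mxactR transition_op hv s)) => -[[n1 n2] n3] [[i1
    i2] i3].
  move=> /and3P[/= h1 h2 h3]; have [e0 eL eR _ _] := sys n1 n2 n3 i1 i2 i3 h1 h2 h3.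
  have [->|->|->] := ord3P s.
  - by rewrite (component_transition0 v h1 h2 h3) -e0 subrr.
  - by rewrite (component_transitionL v h1 h2 h3) -eL subrr.
  - by rewrite (component_transitionR v h1 h2 h3) -eR subrr.
apply: (box_unit_complete (sqk_mxactR halting_op hv s)) => -[[n1 n2] n3] [[i1 i2] i3].
move=> /and3P[/= h1 h2 h3]; have [_ _ _ eL eR] := sys n1 n2 n3 i1 i2 i3 h1 h2 h3.
have [->|->|->] := ord3P s.
- by rewrite halting0 rconv0r.
- by rewrite (component_haltingL v n3 i3 h1 h2) eL.
- by rewrite (component_haltingR v n3 i3 h1 h2) eR.
Qed.

(** * Chains and the projections onto them *)

Notation index := (nat * nat * nat * nat)%type.

(* An index (a, b, m, d) encodes a block size (a + 1, b + 1, m + d + 5) and a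
   starting position m + 4 on the third tape. *)
Definition chain_size (c : index) : nat * nat * nat :=
  (c.1.1.1.+1, c.1.1.2.+1, (c.1.2 + 4 + c.2).+1).
Definition chain_start (c : index) : nat := (c.1.2 + 4)%N.
Definition survives (c : index) : bool :=
  ~~ scan_completes (chain_size c).1.1 (chain_size c).1.2 (chain_size c).2
    (chain_start c).

Definition label (n : nat * nat * nat) (s : 'I_3) (i : nat * nat * nat) : nat :=
  match val s with
  | 0%N => label0 i.1.1 i.1.2 i.2
  | 1%N => labelL n.1.1 n.1.2 i.1.1 i.1.2 i.2
  | _ => labelR n.1.1 n.1.2 i.1.1 i.1.2 i.2
  end.

Definition onchain c s i := label (chain_size c) s i == chain_start c.

Notation chain_box c := ('I_(chain_size c).1.1 * 'I_(chain_size c).1.2 *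
  'I_(chain_size c).2)%type.
Definition coords c (i : chain_box c) : nat * nat * nat :=
  (val i.1.1, val i.1.2, val i.2).

(** As a column over [s], this carries the range of [box_proj] to vectors that are constant along
    the chain and 0 elsewhere. *)
Definition chain_vec c s : group_ring H :=
  \sum_(i : chain_box c | onchain c s (coords i)) box_unit (chain_size c) (coords i).
Definition chain_len c := (\sum_(s < 3) #|[pred i : chain_box c | onchain c s
  (coords i)]|)%N.
Definition box_proj n : group_ring H :=
  ten3 (block_proj n.1.1) (block_proj n.1.2) (block_proj n.2).

Lemma inbox_coords c (i : chain_box c) : inbox (chain_size c) (coords i).
Proof. by rewrite /inbox /coords /= !ltn_ord. Qed.

Lemma coords_inj c : injective (@coords c).
Proof. by move=> [[i1 i2] i3] [[j1 j2] j3] [] /val_inj -> /val_inj -> /val_inj ->.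
  Qed.

Lemma coords_surj c i : inbox (chain_size c) i ->
  exists j : chain_box c, coords j = i.
Proof.
case: i => [[i1 i2] i3] /and3P[h1 h2 h3].
by exists (Ordinal h1, Ordinal h2, Ordinal h3).
Qed.

Lemma star_unit_unit3 n n' i i' : inbox n i -> inbox n' i' ->
  gr_star (box_unit n i) * box_unit n' i' =
    if (n == n') && (i == i') then box_proj n else 0.
Proof.
case: n n' i i' => [[n1 n2] n3] [[m1 m2] m3] [[i1 i2] i3] [[j1 j2] j3].
move=> /and3P[/= a1 a2 a3] /and3P[/= b1 b2 b3].
rewrite /box_unit star_ten3 ten3M /= !star_unit_unit // /box_proj !xpair_eqE /=.
move: (n1 == m1) (i1 == j1) (n2 == m2) (i2 == j2) (n3 == m3) (i3 == j3).
by do 6!case; rewrite /= ?ten3_0l ?ten3_0m ?ten3_0r.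
Qed.

Lemma box_unit_proj n i : box_unit n i * box_proj n = box_unit n i.
Proof. by rewrite /box_unit /box_proj ten3M !block_unit_proj. Qed.

Lemma chain_vec_proj c s : chain_vec c s * box_proj (chain_size c) = chain_vec c s.
Proof. by rewrite /chain_vec mulr_suml; apply: eq_bigr => i _;
  rewrite box_unit_proj. Qed.

Lemma star_unit_chain_vec n i c s : inbox n i ->
  gr_star (box_unit n i) * chain_vec c s =
  if (n == chain_size c) && onchain c s i then box_proj (chain_size c) else 0.
Proof.
move=> hi; rewrite /chain_vec mulr_sumr.
have [e|ne] := eqVneq n (chain_size c); last first.
  rewrite big1 // => j _; rewrite star_unit_unit3 ?inbox_coords //.
  by rewrite (negbTE ne).
rewrite /= {}e in hi *; have [j <-] := coords_surj hi.
have [on|off] := boolP (onchain c s (coords j)).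
  rewrite (bigD1 j) //= star_unit_unit3 ?inbox_coords // !eqxx /= big1 ?addr0 //.
  move=> l /andP[_ lj]; rewrite star_unit_unit3 ?inbox_coords // eqxx /=.
  by rewrite (inj_eq (@coords_inj c)) eq_sym (negbTE lj).
rewrite big1 // => l onl; rewrite star_unit_unit3 ?inbox_coords // eqxx /=.
rewrite (inj_eq (@coords_inj c)); case: eqP => // e.
by move: off; rewrite e onl.
Qed.

Lemma chain_size_start_inj c c' : chain_size c = chain_size c' ->
  chain_start c = chain_start c' -> c = c'.
Proof.
case: c c' => [[[a b] m] d] [[[a' b'] m'] d'] [-> ->] e3.
rewrite /chain_start /= => e; have -> : m = m' by lia.
by have -> : d = d' by lia.
Qed.

(** Distinct chains in one box have different starts, hence different labels, and share no
    configuration. On a single chain, each of its [chain_len c] units contributes one copy of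
    [box_proj]. *)
Lemma star_chain_vec c c' : \sum_s gr_star (chain_vec c s) * chain_vec c' s =
  if c == c' then box_proj (chain_size c) *+ chain_len c else 0.
Proof.
have e s : gr_star (chain_vec c s) * chain_vec c' s =
    \sum_(i : chain_box c | onchain c s (coords i)) gr_star (box_unit (chain_size c)
      (coords i)) * chain_vec c' s.
  by rewrite {1}/chain_vec raddf_sum mulr_suml.
under eq_bigr do rewrite e; have [<-|ne] := eqVneq c c'.
  rewrite /chain_len -sumrMnr; apply: eq_bigr => s _.
  rewrite (eq_bigr (fun=> box_proj (chain_size c))) => [|i on].
    by rewrite sumr_const.
  by rewrite star_unit_chain_vec ?inbox_coords // eqxx on.
rewrite big1 // => s _; rewrite big1 // => i on.
rewrite star_unit_chain_vec ?inbox_coords //; case: eqP => //= e1;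
  case: ifP => // on'.
case/eqP: ne; apply: chain_size_start_inj => //.
by move: on on'; rewrite /onchain -e1 => /eqP <- /eqP <-.
Qed.

Lemma chain_len_gt0 c : (0 < chain_len c)%N.
Proof.
have h : inbox (chain_size c) (0%N, 0%N, chain_start c).
  by rewrite /inbox /chain_size /chain_start /=; lia.
have [j ej] := coords_surj h.
rewrite /chain_len (bigD1 s0) //= ltn_addr //; apply/card_gt0P; exists j.
by rewrite inE ej /onchain /label /label0 /= eqxx.
Qed.

Definition chain_adj c (v : 'I_3 -> H -> R) : H -> R :=
  \sum_s rconv (gr_star (chain_vec c s)) (v s).
(** The column of the [chain_vec c s] times its adjoint, divided by the length; [star_chain_vec]
    makes it a projection. *)
Definition chain_op c (v : 'I_3 -> H -> R) : 'I_3 -> H -> R :=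
  fun s x => (chain_len c)%:R^-1 * rconv (chain_vec c s) (chain_adj c v) x.

Lemma sq_chain_adj c v : sqk v -> sq (chain_adj c v).
Proof. by move=> hv; apply: sq_sum => s _; exact: sq_rconv. Qed.

Lemma sqk_chain_op c v : sqk v -> sqk (chain_op c v).
Proof. by move=> hv s; apply: sqZ; apply: sq_rconv; exact: sq_chain_adj. Qed.

Lemma ipk_chain_op c v v' : sqk v -> sqk v' ->
  ipk (chain_op c v) v' = (chain_len c)%:R^-1 * ip (chain_adj c v) (chain_adj c v').
Proof.
move=> hv hv'; have hs := sq_chain_adj c hv.
rewrite ipkE (ipC (chain_adj c v)) {2}/chain_adj ip_suml //; last first.
  by move=> s _; exact: sq_rconv.
rewrite big_distrr; apply: eq_bigr => s _;
  rewrite /chain_op (ipZl _ (sq_rconv _ hs) (hv' s)).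
by rewrite ip_rconv // ipC.
Qed.

Lemma ipk_chain_op_adj c v v' : sqk v -> sqk v' ->
  ipk (chain_op c v) v' = ipk v (chain_op c v').
Proof. by move=> hv hv'; rewrite ipk_chain_op // ipkC ipk_chain_op // (ipC
  (chain_adj c v')). Qed.

Lemma star_box_proj n : gr_star (box_proj n) = box_proj n.
Proof. by rewrite /box_proj star_ten3 !star_block_proj. Qed.

Lemma box_proj_chain_adj c v : rconv (box_proj (chain_size c)) (chain_adj c v) =
  chain_adj c v.
Proof.
rewrite /chain_adj raddf_sum; apply: eq_bigr => s _ /=.
by rewrite -rconvM -(star_box_proj (chain_size c)) -starM chain_vec_proj.
Qed.

Lemma chain_adj_op c c' v : chain_adj c (chain_op c' v) =
  if c == c' then chain_adj c v else 0.
Proof.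
have e : chain_adj c (chain_op c' v) = fun x => (chain_len c')%:R^-1 *
    rconv (\sum_s gr_star (chain_vec c s) * chain_vec c' s) (chain_adj c' v) x.
  apply/funext => x; rewrite {1}/chain_adj fct_sumE rconv_suml fct_sumE big_distrr.
  by apply: eq_bigr => s _; rewrite /chain_op rconvZr rconvM.
rewrite e star_chain_vec; case: eqP => [<-|_]; apply/funext => x.
  by rewrite rconvMn mulKf ?box_proj_chain_adj // pnatr_eq0 -lt0n chain_len_gt0.
by rewrite rconv0l mulr0.
Qed.

Lemma chain_opM c c' v : chain_op c (chain_op c' v) =
  if c == c' then chain_op c v else 0.
Proof.
apply/funext => s; apply/funext => x; rewrite {1}/chain_op chain_adj_op;
  case: eqP => _.
  by [].
by rewrite rconv0r mulr0.
Qed.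

Lemma chain_adjD c v v' : chain_adj c (v + v') = chain_adj c v + chain_adj c v'.
Proof. by rewrite /chain_adj -big_split; apply: eq_bigr => s _; rewrite rconvDr. Qed.

Lemma chain_opD c v v' : chain_op c (v + v') = chain_op c v + chain_op c v'.
Proof.
apply/funext => s; apply/funext => x.
by rewrite {1}/chain_op chain_adjD rconvDr -mulrDr.
Qed.

Lemma chain_op0 c : chain_op c 0 = 0.
Proof.
apply/funext => s; apply/funext => x;
  rewrite /chain_op /chain_adj big1 ?rconv0r ?mulr0 //.
by move=> s' _; exact: rconv0r.
Qed.

Lemma mem_pairs (S1 S2 : eqType) (s1 : seq S1) (s2 : seq S2) x y :
  ((x, y) \in [seq (a, b) | a <- s1, b <- s2]) = (x \in s1) && (y \in s2).
Proof.
apply/allpairsP/andP => [[[a b] /= [ha hb [-> ->]]] //|[hx hy]].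
by exists (x, y).
Qed.

Definition index_box N : seq index :=
  [seq (abm, d) | abm <- [seq (ab, m) | ab <- [seq (a, b) |
     a <- index_iota 0 N, b <- index_iota 0 N], m <- index_iota 0 N],
   d <- index_iota 0 (N ^ 2)%N].
Definition chains N : seq index := [seq c <- index_box N | survives c].

Lemma mem_index_box N a b m d : ((a, b, m, d) \in index_box N) =
  [&& (a < N)%N, (b < N)%N, (m < N)%N & (d < N ^ 2)%N].
Proof. by rewrite !mem_pairs !mem_index_iota /= -!andbA. Qed.

Lemma uniq_chains N : uniq (chains N).
Proof.
apply: filter_uniq; rewrite /index_box.
by do !apply: allpairs_uniq; rewrite ?iota_uniq // => -[? ?] [? ?] _ _ [-> ->].
Qed.

Lemma chains_mono M N : (M <= N)%N -> {subset chains M <= chains N}.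
Proof.
move=> le [[[a b] m] d]; rewrite !mem_filter !mem_index_box => /andP[-> /and4P[h1 h2
  h3 h4]].
rewrite (leq_trans h1 le) (leq_trans h2 le) (leq_trans h3 le).
by rewrite (leq_trans h4) // leq_exp2r.
Qed.

Lemma chains_exhaust c : survives c -> exists N, c \in chains N.
Proof.
case: c => [[[a b] m] d] g; exists (a + b + m + d).+1.
by rewrite mem_filter g mem_index_box /= -mulnn; apply/and4P; split; nia.
Qed.

Definition chains_op N (v : 'I_3 -> H -> R) := \sum_(c <- chains N) chain_op c v.

Lemma sqk_chains_op N v : sqk v -> sqk (chains_op N v).
Proof.
move=> hv s; rewrite /chains_op.
have -> : (\sum_(c <- chains N) chain_op c v) s = \sum_(c <- chains N) chain_op c v s.
  by rewrite fct_sumE.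
by apply: sq_sum => c _; exact: sqk_chain_op.
Qed.

Lemma ipk_chains_op_adj N v v' : sqk v -> sqk v' ->
  ipk (chains_op N v) v' = ipk v (chains_op N v').
Proof.
move=> hv hv'; rewrite /chains_op.
suff [] : sqk (\sum_(c <- chains N) chain_op c v) /\ sqk (\sum_(c <- chains N)
  chain_op c v') /\
    ipk (\sum_(c <- chains N) chain_op c v) v' =
      ipk v (\sum_(c <- chains N) chain_op c v').
  by move=> _ [_ ->].
elim: (chains N) => [|c s [IH1 [IH2 IH3]]].
  rewrite !big_nil ipk0l ipkC ipk0l; split=> [i|]; first exact: sq0.
  by split=> // i; exact: sq0.
have h := sqk_chain_op c hv; have h' := sqk_chain_op c hv'.
rewrite !big_cons; split; first exact: sqkD.
split; first exact: sqkD.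
rewrite (ipkDl h IH1 hv') (ipkC v) (ipkDl h' IH2 hv) IH3 ipk_chain_op_adj //.
by rewrite (ipkC v) (ipkC v).
Qed.

Lemma chain_op_sum c (s : seq index) (F : index -> 'I_3 -> H -> R) :
  chain_op c (\sum_(c' <- s) F c') = \sum_(c' <- s) chain_op c (F c').
Proof. exact: (big_morph (chain_op c) (fun v v' => chain_opD c v v') (chain_op0 c)).
  Qed.

Lemma chains_op_chain_op N c v : c \in chains N ->
  chains_op N (chain_op c v) = chain_op c v.
Proof.
move=> hc; rewrite /chains_op (bigD1_seq c) ?uniq_chains //= chain_opM eqxx.
rewrite big1 ?addr0 // => c' ne; rewrite chain_opM (negbTE ne) //.
Qed.

Lemma chains_op_sum N (s : seq index) (F : index -> 'I_3 -> H -> R) :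
  chains_op N (\sum_(c <- s) F c) = \sum_(c <- s) chains_op N (F c).
Proof.
rewrite /chains_op; under eq_bigr do rewrite chain_op_sum.
by rewrite exchange_big.
Qed.

Lemma chains_op_mono M N v : (M <= N)%N ->
  chains_op N (chains_op M v) = chains_op M v.
Proof.
move=> le; rewrite {2}/chains_op chains_op_sum {2}/chains_op big_seq [RHS]big_seq.
by apply: eq_bigr => c hc; apply: chains_op_chain_op; exact: chains_mono hc.
Qed.

Lemma block_system_ext (V : zmodType) n1 n2 n3 (y0 yL yR z0 zL zR : nat -> nat ->
  nat -> V) :
  (forall i1 i2 i3, (i1 < n1)%N -> (i2 < n2)%N -> (i3 < n3)%N ->
    [/\ y0 i1 i2 i3 = z0 i1 i2 i3, yL i1 i2 i3 = zL i1 i2 i3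
      & yR i1 i2 i3 = zR i1 i2 i3]) ->
  block_system n1 n2 n3 z0 zL zR -> block_system n1 n2 n3 y0 yL yR.
Proof.
move=> e sys i1 i2 i3 h1 h2 h3.
have [a0 aL aR a4 a5] := sys i1 i2 i3 h1 h2 h3.
have [e0 eL eR] := e i1 i2 i3 h1 h2 h3.
have p1 : (i1.-1 < n1)%N by lia. have p2 : (i2.-1 < n2)%N by lia.
have p3 : (i3.-1 < n3)%N by lia.
split; rewrite ?e0 ?eL ?eR //.
- rewrite {1}a0; congr (_ + _); case: ifP => // _.
  by have [-> _ _] := e _ _ _ p1 p2 h3.
- rewrite {1}aL; congr (_ + _ + _).
  + by case: ifP => // /andP[l1 _]; have [_ -> _] := e _ _ _ l1 h2 p3.
  + by case: ifP => // /and3P[_ l2 _]; have [_ _ ->] := e _ _ _ h1 l2 p3.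
  + by case: ifP => // _; have [-> _ _] := e _ _ _ h1 h2 p3.
- rewrite {1}aR; congr (_ + _).
  + by case: ifP => // _; have [_ _ ->] := e _ _ _ p1 h2 p3.
  + by case: ifP => // /and3P[_ l2 _]; have [_ -> _] := e _ _ _ h1 l2 p3.
Qed.

(** The components of [chain_op c v] depend only on the label, through a [z] supported at the start
    of [c]; [survives c] provides the condition on completed scans in [block_system_label]. *)
Lemma mxactR_chain_op c v : survives c -> sqk v ->
  mxactR machine_op (chain_op c v) = 0.
Proof.
move=> gc hv; apply/(ker_machine_op (sqk_chain_op c hv)) => n1 n2 n3.
pose z m : H -> R := if ((n1, n2, n3) == chain_size c) && (m == chain_start c)
  then (fun x => (chain_len c)%:R^-1 * chain_adj c v x) else 0.
have comp s i1 i2 i3 : (i1 < n1)%N -> (i2 < n2)%N -> (i3 < n3)%N ->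
    component (chain_op c v) (n1, n2, n3) s i1 i2 i3 =
    z (label (n1, n2, n3) s (i1, i2, i3)).
  move=> h1 h2 h3; have hi : inbox (n1, n2, n3) (i1, i2, i3) by apply/and3P.
  rewrite /component /chain_op rconvZr -rconvM (star_unit_chain_vec _ _ hi) /z
    /onchain.
  case: eqP => [->|_] /=; last by apply/funext => x; rewrite rconv0l mulr0.
  case: ifP => _; last by apply/funext => x; rewrite rconv0l mulr0.
  by rewrite box_proj_chain_adj.
apply: (@block_system_ext _ _ _ _ _ _ _ (fun i1 i2 i3 => z (label0 i1 i2 i3))
  (fun i1 i2 i3 => z (labelL n1 n2 i1 i2 i3)) (fun i1 i2 i3 => z (labelR n1 n2 i1 i2
    i3))).
  by move=> i1 i2 i3 h1 h2 h3; split; exact: comp.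
apply: block_system_label => m.
  by rewrite /z /chain_start => h; case: ifP => // /andP[_ /eqP e]; lia.
move=> b; rewrite /z; case: ifP => // /andP[/eqP e1 /eqP e2]; move: gc.
by rewrite /survives -e1 -e2 b.
Qed.

Lemma mxactR_chains_op N v : sqk v -> mxactR machine_op (chains_op N v) = 0.
Proof.
move=> hv; rewrite /chains_op big_seq;
  apply: (big_ind (fun f => mxactR machine_op f = 0)).
- exact: mxactR0.
- move=> f g ef eg; rewrite -[g]opprK mxactRB ef sub0r -[- g]sub0r mxactRB eg.
  by rewrite mxactR0 subrr oppr0.
- by move=> c; rewrite mem_filter => /andP[gc _]; exact: mxactR_chain_op.
Qed.

Lemma chain_adj_component c v : chain_adj c v =
  \sum_s \sum_(i : chain_box c | onchain c s (coords i))
    component v (chain_size c) s (val i.1.1) (val i.1.2) (val i.2).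
Proof.
rewrite /chain_adj; apply: eq_bigr => s _.
by rewrite /chain_vec raddf_sum rconv_suml; apply: eq_bigr => -[[i1 i2] i3] _.
Qed.

(** In a kernel vector all components along a chain equal the one at its start, so [chain_adj c v]
    is [chain_len c] times that component. Hence the starts of surviving chains vanish; those of
    completed scans vanish by the halting equations, and every component is a start value or 0. *)
Lemma chains_op_complete v : sqk v -> mxactR machine_op v = 0 ->
  (forall N, chains_op N v = 0) -> v = 0.
Proof.
move=> hv Tv Qv; have sys := (ker_machine_op hv).1 Tv.
have X0 c : survives c -> chain_adj c v = 0.
  move=> gc; have [N hN] := chains_exhaust gc.
  have := Qv N => /(congr1 (chain_op c)); rewrite chain_op0 /chains_op chain_op_sum.
  rewrite (bigD1_seq c hN (uniq_chains N)) /= chain_opM eqxx big1 => [|c' ne];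
    last first.
    by rewrite chain_opM eq_sym (negbTE ne).
  rewrite addr0 => qv.
  have : chain_adj c (chain_op c v) = 0.
    by rewrite qv /chain_adj big1 // => s _; exact: rconv0r.
  by rewrite chain_adj_op eqxx.
have compE n1 n2 n3 s i1 i2 i3 : (i1 < n1)%N -> (i2 < n2)%N -> (i3 < n3)%N ->
    component v (n1, n2, n3) s i1 i2 i3 =
    start_value (component v (n1, n2, n3) s0) (label (n1, n2, n3) s (i1, i2, i3)).
  move=> h1 h2 h3; have [eL eR] := solveLR (sys n1 n2 n3) h1 h2 h3.
  have e0 := solve0 (sys n1 n2 n3) h1 h2 h3.
  by have [->|->|->] := ord3P s; [exact: e0|exact: eL|exact: eR].
have start0 n1 n2 n3 m : (0 < n1)%N -> (0 < n2)%N -> (m < n3)%N -> (3 < m)%N ->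
    component v (n1, n2, n3) s0 0%N 0%N m = 0.
  move=> h1 h2 h3 m3; have [b|g] := boolP (scan_completes n1 n2 n3 m).
    exact: (solve_completed_scan (sys n1 n2 n3) m3 b).
  (* The index of the chain with this box and start; [3 < m < n3] makes the subtractions exact. *)
  pose c : index := (n1.-1, n2.-1, m - 4, n3 - m - 1)%N.
  have ec : chain_size c = (n1, n2, n3).
    by rewrite /chain_size /c /=; congr (_, _, _); lia.
  have em : chain_start c = m by rewrite /chain_start /c /=; lia.
  have gc : survives c by rewrite /survives ec em.
  have := X0 c gc; rewrite chain_adj_component => e.
  have : (component v (n1, n2, n3) s0 0%N 0%N m) *+ chain_len c = 0.
    rewrite -[RHS]e /chain_len -sumrMnr; apply: eq_bigr => s _.
    rewrite (eq_bigr (fun=> component v (n1, n2, n3) s0 0%N 0%N m)).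
      by rewrite sumr_const.
    have onE n j1 j2 j3 : n = (n1, n2, n3) -> inbox n (j1, j2, j3) ->
        label n s (j1, j2, j3) = m ->
        component v n s j1 j2 j3 = component v (n1, n2, n3) s0 0%N 0%N m.
      move=> -> /and3P[l1 l2 l3] lab.
      by rewrite (compE _ _ _ s _ _ _ l1 l2 l3) lab /start_value m3.
    move=> i /eqP on; apply: (onE _ _ _ _ ec (inbox_coords i)).
    by rewrite -[LHS]/(label (chain_size c) s (coords i)) on em.
  move=> /(congr1 (fun f : H -> R => f)) e0; apply/funext => x.
  have := congr1 (fun f : H -> R => f x) e0; rewrite natmulfctE => /eqP.
  by rewrite mulrn_eq0 gtn_eqF ?chain_len_gt0 //= => /eqP.
apply/funext => s; apply: (box_unit_complete (hv s)) => -[[n1 n2] n3] [[i1 i2] i3].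
move=> /and3P[/= h1 h2 h3].
rewrite -[LHS]/(component v (n1, n2, n3) s i1 i2 i3) compE // /start_value.
case: ifP => // l3; apply: start0 => //; try lia.
rewrite (leq_ltn_trans _ h3) // /label; case: (val s) => [|[|?]] /=.
- by rewrite /label0; case: ifP.
- by rewrite /labelL; case: ifP => // _; exact: leq_subr.
- by rewrite /labelR; case: ifP => // _; exact: leq_subr.
Qed.

Lemma trace_box_proj c : (box_proj (chain_size c))@_1%g =
  2^-1 ^+ (c.1.1.1 + c.1.1.2 + c.1.2 + c.2 + 10).
Proof.
rewrite /box_proj trace_ten3 !block_proj_trace // -!exprD; congr (_ ^+ _).
by rewrite /chain_size /=; lia.
Qed.

(** Traciality and [star_chain_vec] give [chain_len c] times the trace of [box_proj], and the
    normalization of [chain_op] cancels the length. *)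
Lemma trace_chain_op c : \sum_s chain_op c (zetaR R s) s 1%g =
  2^-1 ^+ (c.1.1.1 + c.1.1.2 + c.1.2 + c.2 + 10).
Proof.
have e s : chain_adj c (zetaR R s) = rconv (gr_star (chain_vec c s)) (delta R 1%g).
  rewrite /chain_adj (bigD1 s) //= big1 ?addr0 => [|s' /negbTE ne].
    by rewrite /zetaR eqxx.
  by rewrite /zetaR ne rconv0r.
rewrite /chain_op; under eq_bigr do rewrite e -rconvM rconv_delta trC.
rewrite -big_distrr -rmorph_sum /= -coef_sum star_chain_vec eqxx.
have -> : (box_proj (chain_size c) *+ chain_len c)@_1%g =
  (chain_len c)%:R * (box_proj (chain_size c))@_1%g.
  elim: (chain_len c) => [|k IH]; first by rewrite mulr0n coef0 mul0r.
  by rewrite mulrSr coefD IH -natr1 mulrDl mul1r.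
rewrite rmorphM /= ratr_nat mulKf ?pnatr_eq0 -?lt0n ?chain_len_gt0 // trace_box_proj.
by rewrite rmorphXn fmorphV rmorph_nat.
Qed.

Lemma trace_chains_op N : \sum_s chains_op N (zetaR R s) s 1%g =
  \sum_(c <- chains N) 2^-1 ^+ (c.1.1.1 + c.1.1.2 + c.1.2 + c.2 + 10).
Proof.
under eq_bigr do rewrite /chains_op !fct_sumE.
by rewrite exchange_big; apply: eq_bigr => c _; exact: trace_chain_op.
Qed.

Lemma survives_index a b m d : survives (a, b, m, d) =
  ~~ [&& a == b, (0 < a)%N & (a.+1 ^ 2 <= d)%N].
Proof.
rewrite /survives /scan_completes /chain_size /chain_start /= eqSS ltnS;
  congr (~~ [&& _, _ & _]).
by apply/idP/idP; lia.
Qed.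

Lemma trace_chain_weight N : \sum_s chains_op N (zetaR R s) s 1%g = chain_weight R N.
Proof.
rewrite trace_chains_op big_filter big_mkcond /index_box /chain_weight !big_allpairs.
apply: eq_bigr => a _; apply: eq_bigr => b _; apply: eq_bigr => m _.
by apply: eq_bigr => d _; rewrite survives_index.
Qed.

Theorem is_dim_ker_three_tapes :
  is_dim_ker machine_op (64^-1 - 8^-1 * limn (partial_series R)).
Proof.
apply: (@is_dim_ker_lim R H 3 machine_op chains_op sqk_chains_op ipk_chains_op_adj _
  mxactR_chains_op chains_op_complete).
  by move=> M N v le _; exact: chains_op_mono.
under eq_fun do rewrite trace_chain_weight.
exact: chain_weight_cvg.
Qed.

End ThreeTapes.

(** * Tapes in the lamplighter group *)

Section Tape.

Variable G : groupType.
Variables (lshift : G) (lamp : int -> G) (bit : G -> int -> bool).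
Hypothesis lampK : forall m, (lamp m * lamp m)%g = 1%g.
Hypothesis lampC : forall m m', (lamp m * lamp m')%g = (lamp m' * lamp m)%g.
Hypothesis lshift_lamp : forall m, (lshift * lamp m)%g = (lamp (m + 1) * lshift)%g.
Hypothesis bit1 : forall m, bit 1%g m = false.
Hypothesis bit_lamp : forall m x m', bit (lamp m * x)%g m' = (m == m') (+) bit x m'.

Notation A := (group_ring G).

Lemma lampV m : (lamp m)^-1%g = lamp m.
Proof. exact: mulg1_eq (lampK m). Qed.

Definition shiftU : A := mon 1 lshift.
Definition shiftV : A := mon 1 (lshift^-1)%g.

Lemma shiftUV : shiftU * shiftV = 1.
Proof. by rewrite /shiftU /shiftV monM mulgV mulr1. Qed.
Lemma shiftVU : shiftV * shiftU = 1.
Proof. by rewrite /shiftU /shiftV monM mulVg mulr1. Qed.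

Lemma shiftVXU n m : (n <= m)%N -> shiftV ^+ n * shiftU ^+ m = shiftU ^+ (m - n).
Proof.
elim: n m => [|n IH] [|m] //= le; first by rewrite expr0 mul1r subn0.
  by rewrite expr0 mul1r subn0.
by rewrite exprSr exprS mulrA -(mulrA _ shiftV) shiftVU mulr1 IH.
Qed.

Lemma shiftUE : shiftU = mon 1 lshift. Proof. by []. Qed.
Lemma star_shiftU : gr_star shiftU = shiftV. Proof. by rewrite star_mon. Qed.
Lemma star_shiftV : gr_star shiftV = shiftU. Proof. by rewrite star_mon invgK. Qed.

Opaque shiftU shiftV.

Lemma starX (a : A) n : gr_star (a ^+ n) = gr_star a ^+ n.
Proof. by elim: n => [|n IH]; rewrite ?star1 // exprSr starM IH exprS. Qed.

(* [cell (m, b)] is the spectral projection of the lamp at [m]: onto the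
   eigenvalue [1] (a zero on the tape) if [b] is false, [-1] otherwise. *)
Definition cell (p : int * bool) : A :=
  mon 2^-1 1%g + mon (if p.2 then - 2^-1 else 2^-1) (lamp p.1).

Lemma cell_comm p q : cell p * cell q = cell q * cell p.
Proof.
rewrite /cell !(mulrDl, mulrDr) !monM !mulg1 !mul1g (lampC q.1).
move: (if p.2 then _ else _) (if q.2 then _ else _) => a b.
by rewrite (mulrC b a) (mulrC a 2^-1) (mulrC b 2^-1) addrACA.
Qed.

Lemma cellD m : cell (m, false) + cell (m, true) = 1.
Proof.
rewrite /cell /= addrACA -!monD subrr [mon 0 _]monalgU0 addr0 oneE.
by congr mon.
Qed.

Lemma cellN m : cell (m, true) = 1 - cell (m, false).
Proof. by rewrite -(cellD m) addrC addKr. Qed.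

Lemma cell_idem p : cell p * cell p = cell p.
Proof.
case: p => m b; rewrite /cell !(mulrDl, mulrDr) !monM !mulg1 !mul1g lampK /=.
rewrite addrACA [X in _ + X]addrC -addrACA -!monD.
by case: b; congr (mon _ _ + mon _ _).
Qed.

Lemma cell_conflict m b : cell (m, ~~ b) * cell (m, b) = 0.
Proof.
case: b; rewrite /= cellN ?mulrBr ?mulrBl ?mulr1 ?mul1r cell_idem ?subrr //.
Qed.

Lemma star_cell p : gr_star (cell p) = cell p.
Proof. by rewrite /cell raddfD /= !star_mon invg1 lampV. Qed.

Lemma cellE p : cell p =
  mon 2^-1 1%g + mon (if p.2 then - 2^-1 else 2^-1) (lamp p.1).
Proof. by []. Qed.

Opaque cell.

Definition move_cell (k : int) (p : int * bool) := (p.1 + k, p.2).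

Lemma shiftU_cell p : shiftU * cell p = cell (move_cell 1 p) * shiftU.
Proof.
rewrite shiftUE !cellE mulrDr mulrDl !monM mulg1 mul1g lshift_lamp.
by rewrite ![1 * _]mulrC.
Qed.

(** In the dual group of the lamps this is the indicator of a cylinder set of tapes, with the
    symbols listed in [s] prescribed; its trace is the measure of that set. *)
Definition cyl (s : seq (int * bool)) : A := \prod_(p <- s) cell p.

Lemma cyl_nil : cyl [::] = 1. Proof. exact: big_nil. Qed.
Lemma cyl_cons p s : cyl (p :: s) = cell p * cyl s. Proof. exact: big_cons. Qed.
Lemma cyl_cat s s' : cyl (s ++ s') = cyl s * cyl s'. Proof. exact: big_cat. Qed.

Opaque cyl.

Lemma cell_cyl p s : cell p * cyl s = cyl s * cell p.
Proof.
elim: s => [|q s IH]; first by rewrite cyl_nil mulr1 mul1r.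
by rewrite cyl_cons mulrA cell_comm -mulrA IH mulrA.
Qed.

Lemma cyl_comm s s' : cyl s * cyl s' = cyl s' * cyl s.
Proof.
elim: s => [|q s IH]; first by rewrite cyl_nil mulr1 mul1r.
by rewrite cyl_cons -mulrA IH mulrA cell_cyl mulrA.
Qed.

Lemma cyl_absorb p s : p \in s -> cell p * cyl s = cyl s.
Proof.
elim: s => // q s IH; rewrite inE cyl_cons => /orP[/eqP ->|/IH h].
  by rewrite mulrA cell_idem.
by rewrite mulrA cell_comm -mulrA h.
Qed.

Lemma cyl_kill m b s : (m, b) \in s -> cell (m, ~~ b) * cyl s = 0.
Proof. by move=> /cyl_absorb <-; rewrite mulrA cell_conflict mul0r. Qed.

Lemma cyl_sub s s' : {subset s <= s'} -> cyl s * cyl s' = cyl s'.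
Proof.
elim: s => [|q s IH] h; first by rewrite cyl_nil mul1r.
rewrite cyl_cons -mulrA IH => [|x xs]; last by rewrite h // inE xs orbT.
by rewrite cyl_absorb // h // mem_head.
Qed.

Lemma cyl_eq_mem s s' : s =i s' -> cyl s = cyl s'.
Proof.
move=> h; rewrite -[RHS](@cyl_sub s) => [|x]; last by rewrite h.
by rewrite cyl_comm cyl_sub // => x; rewrite h.
Qed.

Lemma cyl_idem s : cyl s * cyl s = cyl s. Proof. exact: cyl_sub. Qed.

Lemma cyl_conflict m b s s' : (m, b) \in s -> (m, ~~ b) \in s' ->
  cyl s * cyl s' = 0.
Proof.
move=> h /cyl_absorb <-; rewrite mulrA -cell_cyl cyl_kill // mul0r //.
Qed.

Lemma star_cyl s : gr_star (cyl s) = cyl s.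
Proof.
elim: s => [|q s IH]; first by rewrite cyl_nil star1.
by rewrite cyl_cons starM IH star_cell -cell_cyl.
Qed.

Lemma shiftUX_cell n p : shiftU ^+ n * cell p = cell (move_cell n%:Z p) * shiftU ^+ n.
Proof.
elim: n p => [|n IH] p; first by case: p => m b; rewrite /move_cell addr0 mulr1 mul1r.
rewrite exprSr -mulrA shiftU_cell mulrA IH -mulrA; congr (cell _ * _).
by rewrite /move_cell /= -addrA -PoszD add1n.
Qed.

Lemma shiftUX_cyl n s : shiftU ^+ n * cyl s =
  cyl (map (move_cell n%:Z) s) * shiftU ^+ n.
Proof.
elim: s => [|p s IH]; first by rewrite cyl_nil mulr1 mul1r.
by rewrite /= !cyl_cons mulrA shiftUX_cell -mulrA IH mulrA.
Qed.

Lemma cyl_shiftUX n s : cyl s * shiftU ^+ n =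
  shiftU ^+ n * cyl (map (move_cell (- n%:Z)) s).
Proof.
rewrite shiftUX_cyl -map_comp; congr (cyl _ * _).
by rewrite -[LHS]map_id; apply: eq_map => -[m b]; rewrite /move_cell /= subrK.
Qed.

Lemma cell_shiftUX n p : cell p * shiftU ^+ n =
  shiftU ^+ n * cell (move_cell (- n%:Z) p).
Proof. by have := cyl_shiftUX n [:: p]; rewrite /= !cyl_cons cyl_nil !mulr1. Qed.

Lemma coef_cell_mul p a x : (cell p * a)@_x =
  2^-1 * a@_x + (if p.2 then - 2^-1 else 2^-1) * a@_(lamp p.1 * x)%g.
Proof. by rewrite cellE mulrDl coefD !coef_mon_mul invg1 mul1g lampV. Qed.

(** Expanding the product only produces lamps at positions listed in [s]. So the lamp at a new
    position does not occur, which is what the trace computation needs. *)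
Lemma cyl_supp s x m : (cyl s)@_x != 0 -> m \notin map fst s -> bit x m = false.
Proof.
elim: s x => [|p s IH] x.
  rewrite cyl_nil oneE coef_mon; case: (1%g =P x) => [<- _ _|_]; first exact: bit1.
  by rewrite mulr0n eqxx.
rewrite cyl_cons coef_cell_mul inE negb_or.
have [e0 h|e0 _] := eqVneq ((cyl s)@_x) 0; last first.
  by move=> /andP[_ ms]; exact: IH e0 ms.
have {}h : (cyl s)@_(lamp p.1 * x)%g != 0.
  by apply: contraNneq h => ->; rewrite e0 !mulr0 addr0.
move=> /andP[mp ms]; have := IH _ h ms.
by rewrite bit_lamp eq_sym (negbTE mp).
Qed.

Lemma cyl_trace s : uniq (map fst s) -> (cyl s)@_1%g = 2^-1 ^+ size s.
Proof.
elim: s => [|p s IH] /=; first by rewrite cyl_nil oneE coef_mon eqxx expr0.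
move=> /andP[ps /IH e]; rewrite cyl_cons coef_cell_mul e mulg1.
have -> : (cyl s)@_(lamp p.1) = 0.
  apply/eqP; apply: contraT => /cyl_supp /(_ ps).
  by rewrite -[lamp _]mulg1 bit_lamp eqxx bit1.
by rewrite mulr0 addr0 exprS.
Qed.

Definition stepr : A := cell (0, false) * shiftU.
Definition stepl : A := shiftV * cell (0, false).

Lemma steprE : stepr = cell (0, false) * shiftU. Proof. by []. Qed.
Lemma steplE : stepl = shiftV * cell (0, false). Proof. by []. Qed.

Lemma star_stepr : gr_star stepr = stepl.
Proof. by rewrite starM star_cell star_shiftU. Qed.
Lemma star_stepl : gr_star stepl = stepr.
Proof. by rewrite starM star_cell star_shiftV. Qed.

Opaque stepr stepl.

(** Size [n] means [n] head positions, hence [n - 1] zeros between two ones; these [n + 1]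
    prescribed cells give the weight. The positions are negative because [shiftU] moves prescribed
    cells up, and the left end of the block is the case of no shift. *)
Definition block (n : nat) : seq (int * bool) :=
  (0, true) :: (- n%:Z, true) :: [seq (- k%:Z, false) | k <- iota 1 n.-1].

Definition block_proj n : A := cyl (block n).
Lemma block_projE n : block_proj n = cyl (block n). Proof. by []. Qed.
Opaque block_proj.

Definition block_unit n i : A := shiftU ^+ i * block_proj n.

Lemma mem_block n k : (0 < k < n)%N -> (- k%:Z, false) \in block n.
Proof.
move=> h; rewrite /block !inE; apply/orP; right; apply/orP; right.
by apply/mapP; exists k => //; rewrite mem_iota; lia.
Qed.

Lemma block0 n : (0, true) \in block n. Proof. exact: mem_head. Qed.
Lemma blockn n : (- n%:Z, true) \in block n.
Proof. by rewrite /block !inE eqxx orbT. Qed.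

Lemma cell_block_proj n k : (0 < k < n)%N ->
  cell (- k%:Z, false) * block_proj n = block_proj n.
Proof. by move=> h; rewrite block_projE; apply: cyl_absorb; exact: mem_block. Qed.

Lemma cell0_block_proj n : cell (0, false) * block_proj n = 0.
Proof. by rewrite block_projE; exact: (cyl_kill (b := true) (block0 n)). Qed.

Lemma celln_block_proj n : cell (- n%:Z, false) * block_proj n = 0.
Proof. by rewrite block_projE; exact: (cyl_kill (b := true) (blockn n)). Qed.

Lemma stepr_unit n i : (i < n)%N ->
  stepr * block_unit n i = if (i.+1 < n)%N then block_unit n i.+1 else 0.
Proof.
move=> lt_in; rewrite steprE /block_unit -!mulrA (mulrA shiftU) -exprS mulrA
  cell_shiftUX -mulrA /move_cell /= add0r.
case: ltnP => h; first by rewrite cell_block_proj.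
have -> : i.+1 = n by lia.
by rewrite celln_block_proj mulr0.
Qed.

Lemma stepl_unit n i : (i < n)%N ->
  stepl * block_unit n i = if (0 < i)%N then block_unit n i.-1 else 0.
Proof.
move=> lt_in; rewrite steplE /block_unit -!mulrA (mulrA (cell _)) cell_shiftUX
  -(mulrA (shiftU ^+ i)) /move_cell /= add0r.
case: i lt_in => [|i] lt_in; first by rewrite cell0_block_proj !mulr0.
by rewrite cell_block_proj // exprS mulrA mulrA shiftVU mul1r.
Qed.

Lemma star_block_unit n i : gr_star (block_unit n i) = block_proj n * shiftV ^+ i.
Proof. by rewrite starM starX star_shiftU block_projE star_cyl. Qed.

Lemma block_proj_idem n : block_proj n * block_proj n = block_proj n.
Proof. by rewrite block_projE cyl_idem. Qed.
Lemma star_block_proj n : gr_star (block_proj n) = block_proj n.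
Proof. by rewrite block_projE star_cyl. Qed.

Lemma block_unit_proj n i : block_unit n i * block_proj n = block_unit n i.
Proof. by rewrite /block_unit -mulrA block_proj_idem. Qed.

(** The cell at [- n] holds 1 for size [n] and 0 for every larger size. *)
Lemma block_proj_orth n n' : (0 < n)%N -> (0 < n')%N -> n != n' ->
  block_proj n * block_proj n' = 0.
Proof.
have lt m m' : (0 < m)%N -> (m < m')%N -> block_proj m * block_proj m' = 0.
  by move=> m0 mm; rewrite !block_projE; apply: (cyl_conflict (blockn m));
    apply: mem_block; rewrite m0.
move=> n0 n0'; rewrite neq_ltn => /orP[h|h]; first exact: lt.
by rewrite !block_projE cyl_comm -!block_projE; exact: lt.
Qed.

Lemma star_unit_unit n n' i i' : (i < n)%N -> (i' < n')%N ->
  gr_star (block_unit n i) * block_unit n' i' =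
    if (n == n') && (i == i') then block_proj n else 0.
Proof.
have lt m m' j j' : (j < j')%N -> (j' < m')%N ->
  gr_star (block_unit m j) * block_unit m' j' = 0.
  move=> jj jm; rewrite star_block_unit /block_unit mulrA -(mulrA (block_proj m))
    shiftVXU; last exact: ltnW.
  (* At [- (j' - j)] the first block has its delimiting one, moved there from 0, while the second
     block has one of its zeros. *)
  rewrite !block_projE cyl_shiftUX -mulrA (@cyl_conflict (- (j' - j)%N%:Z) true)
    ?mulr0 //.
    by apply/mapP; exists (0, true); rewrite ?block0 // /move_cell /= add0r.
  by apply: mem_block; lia.
move=> lt_in lt_in'; have [lti|gti|<-] := ltngtP i i'.
- by rewrite lt // andbF.
- by rewrite -[LHS]starK starM starK lt // raddf0 andbF.
- rewrite star_block_unit /block_unit -mulrA (mulrA (shiftV ^+ i)) (shiftVXU (leqnn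
  i)) subnn expr0 mul1r andbT.
  case: eqP => [<-|/eqP ne]; first exact: block_proj_idem.
  by apply: block_proj_orth => //; [exact: leq_ltn_trans lt_in|exact: leq_ltn_trans
    lt_in'].
Qed.

Lemma block_proj_trace n : (0 < n)%N -> (block_proj n)@_1%g = 2^-1 ^+ n.+1.
Proof.
move=> n0; rewrite block_projE cyl_trace.
  by rewrite /= size_map size_iota prednK.
have -> : map fst (block n) = 0 :: - n%:Z :: [seq - k%:Z | k <- iota 1 n.-1].
  by rewrite /block /= -map_comp.
rewrite /= inE negb_or; apply/and3P; split.
- apply/andP; split; first by lia.
  by apply/mapP => -[k]; rewrite mem_iota => ? ?; lia.
- by apply/mapP => -[k]; rewrite mem_iota => ? ?; lia.
- rewrite map_inj_uniq ?iota_uniq // => a b; lia.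
Qed.

Definition right_run N : A := cyl [seq (k%:Z, false) | k <- iota 0 N].
Definition left_run N : A := cyl [seq (- k%:Z, false) | k <- iota 1 N].

Lemma right_run0 : right_run 0 = 1. Proof. exact: cyl_nil. Qed.
Lemma left_run0 : left_run 0 = 1. Proof. exact: cyl_nil. Qed.

Lemma right_runS N : right_run N - right_run N.+1 =
  cyl ((N%:Z, true) :: [seq (k%:Z, false) | k <- iota 0 N]).
Proof.
have e : iota 0 N.+1 = iota 0 N ++ [:: N] by rewrite -addn1 iotaD.
rewrite /right_run e map_cat /= cyl_cat cyl_cons cyl_nil mulr1.
by rewrite -cell_cyl cyl_cons cellN mulrBl mul1r.
Qed.

Lemma left_runS N : left_run N - left_run N.+1 =
  cyl ((- N.+1%:Z, true) :: [seq (- k%:Z, false) | k <- iota 1 N]).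
Proof.
have e : iota 1 N.+1 = iota 1 N ++ [:: N.+1].
  by rewrite -[X in iota 1 X]addn1 iotaD add1n.
rewrite /left_run e map_cat /= cyl_cat cyl_cons cyl_nil mulr1.
by rewrite -cell_cyl cyl_cons cellN mulrBl mul1r.
Qed.

Lemma shiftUXVX i : shiftU ^+ i * shiftV ^+ i = 1.
Proof.
elim: i => [|i IH]; first by rewrite !expr0 mulr1.
by rewrite exprSr exprS mulrA -(mulrA _ shiftU) shiftUV mulr1.
Qed.

(** Conjugation by [shiftU ^+ i] moves the two ones of the block to [i] and [- j.+1]: exactly [i]
    zeros from 0 upwards and [j] zeros from -1 downwards, as the differences of runs prescribe. *)
Lemma unit_star_unit i j : block_unit (i + j).+1 i * gr_star (block_unit (i + j).+1
  i) =
  (right_run i - right_run i.+1) * (left_run j - left_run j.+1).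
Proof.
rewrite star_block_unit /block_unit mulrA -(mulrA (shiftU ^+ i)) block_proj_idem
  block_projE shiftUX_cyl -mulrA shiftUXVX mulr1.
rewrite right_runS left_runS -cyl_cat; apply: cyl_eq_mem => x.
apply/idP/idP => [/mapP[[m' b']]|].
  rewrite mem_cat !inE !xpair_eqE => /or3P[/andP[/eqP -> /eqP ->] ->|/andP[/eqP ->
    /eqP ->] ->|].
  - by rewrite /move_cell /= add0r eqxx.
  - rewrite /move_cell /= (_ : _ + i%:Z = - j.+1%:Z); last by lia.
    by rewrite eqxx !orbT.
  move=> /mapP[k]; rewrite mem_iota => hk [-> ->] ->.
  have [ki|ki] := leqP k i.
    apply/orP; left; apply/orP; right; apply/mapP; exists (i - k)%N.
      by rewrite mem_iota; lia.
    by rewrite /move_cell /=; congr pair; lia.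
  apply/orP; right; apply/orP; right; apply/mapP; exists (k - i)%N.
    by rewrite mem_iota; lia.
  by rewrite /move_cell /=; congr pair; lia.
have mem0 k : (0 < k < (i + j).+1)%N ->
    exists2 x, x \in block (i + j).+1 & (i%:Z - k%:Z, false) = move_cell i%:Z x.
  move=> hk; exists (- k%:Z, false); first exact: mem_block.
  by rewrite /move_cell /= addrC.
move=> h; apply/mapP; move: h; rewrite mem_cat !inE.
move=> /orP[/orP[/eqP ->|/mapP[k]]|/orP[/eqP ->|/mapP[k]]].
- by exists (0, true); [exact: block0|rewrite /move_cell /= add0r].
- rewrite mem_iota => hk ->; have [|z hz e] := mem0 (i - k)%N; first by lia.
  by exists z => //; rewrite -e; congr pair; lia.
- exists (- (i + j).+1%:Z, true); first exact: blockn.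
  by rewrite /move_cell /=; congr pair; lia.
- rewrite mem_iota => hk ->; have [|z hz e] := mem0 (i + k)%N; first by lia.
  by exists z => //; rewrite -e; congr pair; lia.
Qed.

Lemma right_run_trace N : (right_run N)@_1%g = 2^-1 ^+ N.
Proof.
rewrite cyl_trace; first by rewrite size_map size_iota.
by rewrite -map_comp map_inj_uniq ?iota_uniq // => a b [].
Qed.

Lemma left_run_trace N : (left_run N)@_1%g = 2^-1 ^+ N.
Proof.
rewrite cyl_trace; first by rewrite size_map size_iota.
by rewrite -map_comp map_inj_uniq ?iota_uniq // => a b /= ?; lia.
Qed.

Opaque block_unit right_run left_run.

Definition left_end : A := 1 - stepr * stepl.
Definition right_end : A := 1 - stepl * stepr.

Lemma stepr_stepl_unit n i : (i < n)%N ->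
  stepr * stepl * block_unit n i = if (0 < i)%N then block_unit n i else 0.
Proof.
move=> h; rewrite -mulrA stepl_unit //; case: i h => [|i] h; first by rewrite mulr0.
by rewrite stepr_unit ?h //=; lia.
Qed.

Lemma stepl_stepr_unit n i : (i < n)%N ->
  stepl * stepr * block_unit n i = if (i.+1 < n)%N then block_unit n i else 0.
Proof.
move=> h; rewrite -mulrA stepr_unit //; case: ltnP => h'; last by rewrite mulr0.
by rewrite stepl_unit.
Qed.

Lemma left_end_unit n i : (i < n)%N ->
  left_end * block_unit n i = if i == 0 then block_unit n i else 0.
Proof.
by move=> h; rewrite mulrBl mul1r stepr_stepl_unit //; case: i h => [|i] _;
  rewrite ?subr0 ?subrr.
Qed.

Lemma right_end_unit n i : (i < n)%N ->
  right_end * block_unit n i = if i.+1 == n then block_unit n i else 0.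
Proof.
move=> h; rewrite mulrBl mul1r stepl_stepr_unit //.
by case: (ltngtP i.+1 n) => h'; rewrite ?subrr ?subr0 //; lia.
Qed.

Lemma star_left_end : gr_star left_end = left_end.
Proof. by rewrite /left_end raddfB /= star1 starM star_stepr star_stepl. Qed.

Lemma star_right_end : gr_star right_end = right_end.
Proof. by rewrite /right_end raddfB /= star1 starM star_stepr star_stepl. Qed.

Lemma steplX_unit n i m : (i < n)%N ->
  stepl ^+ m * block_unit n i = if (m <= i)%N then block_unit n (i - m) else 0.
Proof.
elim: m i => [|m IH] i h; first by rewrite mul1r subn0.
rewrite exprSr -mulrA stepl_unit //; case: i h => [|i] h /=; first by rewrite mulr0.
by rewrite IH ?subSS //; lia.
Qed.

Lemma steprX_unit n i m : (i + m < n)%N ->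
  stepr ^+ m * block_unit n i = block_unit n (i + m).
Proof.
elim: m i => [|m IH] i h; first by rewrite mul1r addn0.
by rewrite exprSr -mulrA stepr_unit ?ifT ?IH ?addSnnS //; lia.
Qed.

Opaque GRing.exp.

(** On each block this projects onto the positions from [m] on, the range of the [m]-th power of the
    truncated shift. *)
Definition past m : A := stepr ^+ m * stepl ^+ m.

Lemma pastE m : past m = stepr ^+ m * stepl ^+ m. Proof. by []. Qed.
Opaque left_end right_end past.

Lemma past_unit n i m : (i < n)%N ->
  past m * block_unit n i = if (m <= i)%N then block_unit n i else 0.
Proof.
move=> h; rewrite pastE -mulrA (steplX_unit _ h); case: leqP => h';
  last by rewrite mulr0.
by rewrite steprX_unit ?subnK //; lia.
Qed.

Lemma star_past m : gr_star (past m) = past m.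
Proof. by rewrite pastE starM !starX star_stepr star_stepl. Qed.

End Tape.

(** * The threefold product of a group with a tape *)

Section TripleTensor.
Variable G : groupType.
Notation A := (group_ring G).
Notation H := (G * G * G)%type.

Definition ten3 (a b c : A) : group_ring H := ten (ten a b) c.

Lemma tenNr (G1 G2 : groupType) (a : group_ring G1) (b : group_ring G2) :
  ten a (- b) = - ten a b.
Proof. by apply: coefP => x; rewrite coefN !coef_ten coefN mulrN. Qed.

Lemma ten3M a b c a' b' c' :
  ten3 a b c * ten3 a' b' c' = ten3 (a * a') (b * b') (c * c').
Proof. by rewrite /ten3 !tenM. Qed.

Lemma star_ten3 a b c : gr_star (ten3 a b c) =
  ten3 (gr_star a) (gr_star b) (gr_star c).
Proof. by rewrite /ten3 !star_ten. Qed.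

Lemma ten3_111 : ten3 1 1 1 = 1. Proof. by rewrite /ten3 !ten11. Qed.

Lemma ten3Bl a a' b c : ten3 (a - a') b c = ten3 a b c - ten3 a' b c.
Proof. by rewrite /ten3 !tenDl !tenNl. Qed.

Lemma ten3Bm a b b' c : ten3 a (b - b') c = ten3 a b c - ten3 a b' c.
Proof. by rewrite /ten3 !(tenDr, tenDl) !(tenNr, tenNl). Qed.

Lemma ten3Br a b c c' : ten3 a b (c - c') = ten3 a b c - ten3 a b c'.
Proof. by rewrite /ten3 tenDr tenNr. Qed.

Lemma trace_ten3 a b c : (ten3 a b c)@_1%g = a@_1%g * b@_1%g * c@_1%g.
Proof. by rewrite /ten3 !coef_ten. Qed.

Variables (lshift : G) (lamp : int -> G) (bit : G -> int -> bool).
Hypothesis lampK : forall m, (lamp m * lamp m)%g = 1%g.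
Hypothesis lampC : forall m m', (lamp m * lamp m')%g = (lamp m' * lamp m)%g.
Hypothesis lshift_lamp : forall m, (lshift * lamp m)%g = (lamp (m + 1) * lshift)%g.
Hypothesis bit1 : forall m, bit 1%g m = false.
Hypothesis bit_lamp : forall m x m', bit (lamp m * x)%g m' = (m == m') (+) bit x m'.

Lemma l2_betti_cube (R : realType) :
  @l2_betti R H (64^-1 - 8^-1 * limn (partial_series R)).
Proof.
exists 3%N, (machine_op (stepr lshift lamp) (stepl lshift lamp) (left_end lshift lamp)
  (right_end lshift lamp) (past lshift lamp 4) ten3).
apply: (@is_dim_ker_three_tapes A (@gr_star G) (fun a => a@_1%g) _ _ _
  (stepr lshift lamp) (stepl lshift lamp) (left_end lshift lamp)
  (right_end lshift lamp) (past lshift lamp 4) (block_unit lshift lamp) (block_proj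
    lamp)
  _ _ _ _ _ _ _ _ _ _ _ _ _ _ _ (right_run lamp) (left_run lamp)).
- exact: star1.
- exact: starM.
- by rewrite oneE coef_mon eqxx.
- exact: star_stepr.
- exact: star_stepl.
- exact: star_left_end.
- exact: star_right_end.
- exact: star_past.
- exact: stepr_unit.
- exact: stepl_unit.
- exact: stepr_stepl_unit.
- exact: left_end_unit.
- exact: right_end_unit.
- by move=> n i; exact: past_unit.
- exact: star_unit_unit.
- exact: star_block_proj.
- exact: block_unit_proj.
- exact: block_proj_trace bit1 bit_lamp.
- exact: right_run0.
- exact: left_run0.
- by move=> N; exact: star_cyl.
- by move=> N; exact: star_cyl.
- by move=> N; exact: cyl_idem.
- by move=> N; exact: cyl_idem.
- exact: right_run_trace bit1 bit_lamp.
- exact: left_run_trace bit1 bit_lamp.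
- exact: unit_star_unit.
- exact: ten3M.
- exact: star_ten3.
- exact: ten3Bl.
- exact: ten3Bm.
- exact: ten3Br.
- exact: ten3_111.
- exact: trace_ten3.
Qed.

End TripleTensor.

(** * The lamplighter group as a tape *)

Section Lamps.
Implicit Types x y : lamplighter.

Definition ll_shift : lamplighter := (0, 1).
Definition ll_lamp (m : int) : lamplighter := (<< 1 *g m >>, 0).
Definition ll_bit x (m : int) : bool := x.1@_m != 0.

Lemma ll_mulE x y : (x * y)%g = (x.1 + Defs.shift x.2 y.1, x.2 + y.2).
Proof. by []. Qed.

Lemma ll_lampM m x : (ll_lamp m * x)%g = (<< 1 *g m >> + x.1, x.2).
Proof. by rewrite ll_mulE /= Defs.shift0 add0r. Qed.

Lemma ll_lampK m : (ll_lamp m * ll_lamp m)%g = 1%g.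
Proof.
rewrite ll_lampM /= -monalgUD (_ : 1 + 1 = 0) ?monalgU0 //.
exact: val_inj.
Qed.

Lemma ll_lampC m m' : (ll_lamp m * ll_lamp m')%g = (ll_lamp m' * ll_lamp m)%g.
Proof. by rewrite !ll_lampM /= addrC. Qed.

Lemma ll_shift_lamp m : (ll_shift * ll_lamp m)%g = (ll_lamp (m + 1) * ll_shift)%g.
Proof.
rewrite ll_lampM ll_mulE /= add0r !addr0; congr pair.
apply/malgP => i; rewrite shiftE !mcoeffU.
by rewrite [in RHS]eq_sym -subr_eq eq_sym.
Qed.

Lemma ll_bit1 m : ll_bit 1%g m = false.
Proof. by rewrite /ll_bit mcoeff0 eqxx. Qed.

Lemma ll_bit_lamp m x m' : ll_bit (ll_lamp m * x)%g m' = (m == m') (+) ll_bit x m'.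
Proof.
rewrite /ll_bit ll_lampM /= mcoeffD mcoeffU; case: (m == m') => /=.
  by case: (x.1@_m') => [[|[|k]] lt].
by rewrite mulr0n add0r.
Qed.

End Lamps.

Theorem theorem1p1 (R : realType) :
  let r : R :=
    64^-1 - 8^-1 * limn (fun n : nat =>
      \sum_(1 <= k < n) (2 : R) ^- (k ^ 2 + 4 * k + 6)%N) in
  @l2_betti R (lamplighter * lamplighter * lamplighter)%type r /\ irrational r.
Proof.
move=> r; split; last exact: value_irrational.
exact: (l2_betti_cube ll_lampK ll_lampC ll_shift_lamp ll_bit1 ll_bit_lamp R).
Qed.
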